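(* Let $0<\eta<1$ and $1<\alpha<\frac{1}{\eta}$, and let $f,h:[0,1]\times[0,+\infty)^2\to[0,+\infty)$ be continuous functions. Consider the growth conditions: $(A1)$ $\displaystyle\limsup_{(x,y)\to(0,0)}\ \sup_{t\in[0,1]}\frac{f(t,x,y)}{|x|+|y|}=0$ and $\displaystyle\limsup_{(x,y)\to(0,0)}\ \sup_{t\in[0,1]}\frac{h(t,x,y)}{|x|+|y|}=0$; $(A2)$ $\displaystyle\liminf_{\max\{x,y\}\to+\infty}\ \inf_{t\in[0,1]}\frac{f(t,x,y)}{|x|+|y|}=+\infty$ and $\displaystyle\liminf_{\max\{x,y\}\to+\infty}\ \inf_{t\in[0,1]}\frac{h(t,x,y)}{|x|+|y|}=+\infty$; $(A3)$ $\displaystyle\liminf_{(x,y)\to(0,0)}\ \inf_{t\in[0,1]}\frac{f(t,x,y)}{|x|+|y|}=+\infty$ and $\displaystyle\liminf_{(x,y)\to(0,0)}\ \inf_{t\in[0,1]}\frac{h(t,x,y)}{|x|+|y|}=+\infty$; $(A4)$ $\displaystyle\limsup_{\max\{x,y\}\to+\infty}\ \sup_{t\in[0,1]}\frac{f(t,x,y)}{|x|+|y|}=0$ and $\displaystyle\limsup_{\max\{x,y\}\to+\infty}\ \sup_{t\in[0,1]}\frac{h(t,x,y)}{|x|+|y|}=0$. Suppose that either both $(A1)$ and $(A2)$ hold, or both $(A3)$ and $(A4)$ hold. Then the boundary value problem $$\left\{\begin{array}{l}-u'''(t)=f(t,v(t),v'(t)),\quad t\in[0,1],\\ -v'''(t)=h(t,u(t),u'(t)),\quad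 t\in[0,1],\\ u(0)=u'(0)=0,\quad u'(1)=\alpha u'(\eta),\\ v(0)=v'(0)=0,\quad v'(1)=\alpha v'(\eta)\end{array}\right.$$ has at least one solution $(u,v)\in (C^3[0,1])^2$ that is positive, i.e. $u(t)>0$ and $v(t)>0$ for all $t\in(0,1]$.
   Context: In the limits, $(x,y)$ ranges over $[0,+\infty)^2\setminus\{(0,0)\}$. A solution is a pair $(u,v)\in(C^3[0,1])^2$ satisfying the differential equations and boundary conditions; since $f,h$ are defined only for nonnegative second and third arguments, this includes that $u,u',v,v'$ are nonnegative on $[0,1]$. *)

(* Defs.v *)
From HB Require Import structures.
From mathcomp Require Import all_boot all_order all_algebra.
From mathcomp Require Import all_classical all_reals all_analysis.

Set Implicit Arguments.
Unset Strict Implicit.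
Unset Printing Implicit Defensive.

Import Order.TTheory GRing.Theory Num.Theory.
Import numFieldNormedType.Exports.

Local Open Scope classical_set_scope.
Local Open Scope ring_scope.

Definition unit_itv {R : realType} : set R := [set t | 0 <= t <= 1].

Definition quadrant {R : realType} : set (R * R) :=
  [set p | 0 <= p.1 /\ 0 <= p.2].

(** A function [0,1] x [0,+oo)^2 -> R is represented by a total curried
    function; only its values on the domain are ever used. *)

Definition continuous_on_domain {R : realType} (f : R -> R -> R -> R) : Prop :=
  {within [set q : R * (R * R) | unit_itv q.1 /\ quadrant q.2],
    continuous (fun q => f q.1 q.2.1 q.2.2)}.

Definition nonneg_on_domain {R : realType} (f : R -> R -> R -> R) : Prop :=
  forall t x y, unit_itv t -> quadrant (x, y) -> 0 <= f t x y.

Definition sup_ratio {R : realType} (f : R -> R -> R -> R) (p : R * R) : \bar R :=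
  ereal_sup [set (f t p.1 p.2 / (`|p.1| + `|p.2|))%:E | t in unit_itv].

Definition inf_ratio {R : realType} (f : R -> R -> R -> R) (p : R * R) : \bar R :=
  ereal_inf [set (f t p.1 p.2 / (`|p.1| + `|p.2|))%:E | t in unit_itv].

Definition near_origin {R : realType} : set_system (R * R) :=
  within quadrant ((0, 0) : R * R)^'.

Definition near_infinity {R : realType} : set_system (R * R) :=
  filter_from setT
    (fun M : R => [set p : R * R | quadrant p /\ M < Num.max p.1 p.2]).

Definition superlinear_at {R : realType} (F : set_system (R * R))
    (f : R -> R -> R -> R) : Prop :=
  limf_einf (inf_ratio f) F = +oo%E.

Definition sublinear_at {R : realType} (F : set_system (R * R))
    (f : R -> R -> R -> R) : Prop :=
  limf_esup (sup_ratio f) F = 0%E.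

Definition diff_quot {R : realType} (u : R -> R) (t s : R) : R :=
  (u s - u t) / (s - t).

(** Derivatives are taken relative to [0,1], hence one-sided at 0 and 1, and
    depend only on the restriction of [u] to [0,1]. *)

Definition derivable01 {R : realType} (u : R -> R) : Prop :=
  forall t, unit_itv t -> cvg (diff_quot u t @ within unit_itv t^').

Definition derive01 {R : realType} (u : R -> R) : R -> R :=
  fun t => lim (diff_quot u t @ within unit_itv t^').

Definition derive01n {R : realType} (n : nat) (u : R -> R) : R -> R :=
  iter n derive01 u.

Definition C01 {R : realType} (n : nat) (u : R -> R) : Prop :=
  (forall k, (k < n)%N -> derivable01 (derive01n k u)) /\
  {within unit_itv, continuous (derive01n n u)}.

Definition boundary_conditions {R : realType} (eta alpha : R) (u : R -> R) :
    Prop :=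
  [/\ u 0 = 0, derive01 u 0 = 0 & derive01 u 1 = alpha * derive01 u eta].

(** [f] and [h] are only given for nonnegative second and third arguments, so
    that a solution must have [u], [u'], [v], [v'] nonnegative on [0,1]. *)
Definition bvp_solution {R : realType} (eta alpha : R)
    (f h : R -> R -> R -> R) (u v : R -> R) : Prop :=
  [/\ C01 3 u /\ C01 3 v,
      forall t, unit_itv t ->
        quadrant (u t, derive01 u t) /\ quadrant (v t, derive01 v t),
      forall t, unit_itv t ->
        - derive01n 3 u t = f t (v t) (derive01 v t) /\
        - derive01n 3 v t = h t (u t) (derive01 u t),
      boundary_conditions eta alpha u &
      boundary_conditions eta alpha v].

(* Main.v *)
Require Import Defs.
From HB Require Import structures.
From mathcomp Require Import all_boot.
From mathcomp Require Import zify.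

Set Implicit Arguments.
Unset Strict Implicit.
Unset Printing Implicit Defensive.

(** With [w = u'], each equation and its boundary conditions form the
    three-point problem [- w'' = g], [w 0 = 0], [w 1 = alpha * w eta], whose
    solution is [w t = int green t s * g s ds]; then [u t = int green_int t s *
    g s ds].  For nonnegative [g] the single number [w eta] controls both
    functions: [t * w eta <= w t <= w eta / eta] ([green_ge], [green_le]) and
    [t ^ 2 / 2 * w eta <= u t <= w eta / eta] ([green_int_ge],
    [green_int_le]).  The size of a pair of forcings is the sum of the two
    numbers [w eta], a linear functional.  A solution is a fixed point of the
    operator that sends a pair of forcings to the pair [f (v, v')],
    [h (u, u')], and the growth conditions say that this operator strictly
    increases the size of pairs of one size [p] and strictly decreases the
    size of pairs of another size [q] ([total_load_ge], [total_load_le]).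
    Sublinearity at infinity gives [p < q], superlinearity [q < p].

    The fixed point is found in finite dimension.  Integrals become means over
    the midpoints of a regular grid, and a positive constant tending to 0 is
    added to the forcing, so that its size never vanishes.  The size being
    linear, the nonzero forcings form a product of a half line (the size) and
    a simplex (the direction), on which the cases [p < q] and [q < p] are the
    same statement read in opposite directions
    ([krasnoselskii_orthant]); it reduces to the fixed point theorem of
    Brouwer for a simplex ([brouwer_simplex]), itself a consequence of a
    lemma of Scarf on finitely many linear orders ([scarf]), which is proved
    by a parity count and needs no triangulation.

    The bounds [p] and [q] do not depend on the grid, so the discrete
    solutions can be followed along a free ultrafilter on the integers, where
    every bounded sequence converges.  The limit of the weighted counting
    measures of the forcings is a positive functional [dens], and the
    limits of the discrete solutions are its values on the Green functions.
    The Taylor inequalities of these functions in [t] pass to the limit and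
    show directly that the limits have the right three derivatives
    ([limit_derivatives]); no integral occurs.

    The sizes stay away from 0, so one of [u' eta], [v' eta] is positive.  If
    the other one were 0, its equation would have zero right-hand side, which
    contradicts superlinearity at the origin
    ([limit_slope_eta_nonzero]); under sublinearity at the origin, the
    vanishing of one of the two forces that of the other
    ([limit_slope_eta_vanish]).  The lower bounds above then give
    positivity. *)

(** * Dominating sets in finitely many linear orders *)

(** Pigeonhole with defect one: removing either element of the colliding
    pair makes the map injective, so that pair is the only one. *)
Lemma one_collision (S T : finType) (f : S -> T) (A : {set S}) :
  #|f @: A|.+1 = #|A| ->
  exists i j, [/\ i \in A, j \in A, i != j, f i = f j &
    forall k l, k \in A -> l \in A -> k != l -> f k = f l ->
      (k \in [set i; j]) /\ (l \in [set i; j])].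
Proof.
move=> cA.
have /dinjectivePn[i iA [j]] : ~~ dinjectiveb f A.
  apply/negP => /dinjectiveP/card_in_imset cA'.
  by move: cA; rewrite cA' => /eqP; rewrite eqn_leq ltnn.
rewrite inE /= => /andP[ji jA] fij; exists i, j.
have inj a b : a \in A -> b \in A -> a != b -> f a = f b ->
    {in A :\ a &, injective f}.
  move=> aA bA ab fab; apply/imset_injP; rewrite (_ : f @: (A :\ a) = f @: A).
    by apply/eqP; have := cardsD1 a A; rewrite aA -cA add1n => -[->].
  apply/setP => t; apply/imsetP/imsetP => -[x xA ->].
    by exists x => //; move: xA; rewrite !inE => /andP[].
  have [->|xa] := eqVneq x a; first by exists b; rewrite // !inE eq_sym ab.
  by exists x; rewrite // !inE xa.
split=> //; first by rewrite eq_sym.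
have ij : i != j by rewrite eq_sym.
have Pi := inj _ _ iA jA ij fij; have Pj := inj _ _ jA iA ji (esym fij).
have half k l : k \in A -> l \in A -> k != l -> f k = f l -> k \in [set i; j].
  move=> kA lA /eqP kl fkl; apply/negPn/negP; rewrite !inE negb_or.
  case/andP=> ki kj; apply: kl; have [li|li] := eqVneq l i.
    by apply: Pj; rewrite ?inE ?kj ?li ?ij ?iA ?kA // -li.
  by apply: Pi; rewrite ?inE ?ki ?li ?lA ?kA.
move=> k l kA lA kl fkl; split; first exact: half fkl.
by apply: (half l k) => //; rewrite eq_sym.
Qed.

Section Scarf.
Variables (Z I : finType) (r : I -> Z -> nat) (e : I -> Z).
(** [e i] is a formal slack element: it is the least element for the order of
    [i], while for every other order it lies above all elements that are not
    slack.  It stands for the absence of [i]. *)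
Hypothesis r_inj : forall i, injective (r i).
Hypothesis e_low : forall i z, r i (e i) <= r i z.
Hypothesis e_high :
  forall i j z, i != j -> z \notin codom e -> r i z < r i (e j).

(** No element can be strictly above all of [B] in every order at once. *)
Definition dominating (B : {set Z}) :=
  [forall y, exists i, forall z in B, r i y <= r i z].

Lemma dominating_sub (B B' : {set Z}) :
  B' \subset B -> dominating B -> dominating B'.
Proof.
move=> sB /forallP dB; apply/forallP => y.
have /existsP[i /forall_inP iB] := dB y.
by apply/existsP; exists i; apply/forall_inP => z zB; apply/iB/(subsetP sB).
Qed.

Section Minima.
Variables (B : {set Z}) (b : Z).
Hypothesis bB : b \in B.

Definition min_elt i := [arg min_(z < b in B) r i z].

Lemma min_eltP i :
  min_elt i \in B /\ forall z, z \in B -> r i (min_elt i) <= r i z.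
Proof. by rewrite /min_elt; case: arg_minnP. Qed.

Lemma min_elt_unique i z :
  z \in B -> (forall y, y \in B -> r i z <= r i y) -> z = min_elt i.
Proof.
have [mB mP] := min_eltP i => zB zP; apply: (@r_inj i).
by apply/eqP; rewrite eqn_leq zP // mP.
Qed.

(** Domination applied to an element of [B] itself shows that it is the
    minimum of [B] for some order.  Hence a dominating set has at most as
    many elements as there are orders. *)
Lemma imset_min_elt : dominating B -> min_elt @: [set: I] = B.
Proof.
move=> /forallP dB; apply/setP => z; apply/imsetP/idP => [[i _ ->]|zB].
  by have [] := min_eltP i.
have /existsP[i /forall_inP iB] := dB z; exists i => //.
exact: min_elt_unique.
Qed.

End Minima.

Section Completions.
Variables (B : {set Z}) (b : Z).
Hypotheses (bB : b \in B) (dB : dominating B) (cB : #|B|.+1 = #|I|).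

Let m := min_elt B b.
Let mB i : m i \in B := (min_eltP bB i).1.
Let m_le i z : z \in B -> r i (m i) <= r i z := (min_eltP bB i).2 z.

(** The candidates for enlarging [B] after giving up its minimum for the
    order of [i]: those that leave all other minima unchanged. *)
Definition above_min i := [set y | [forall (k | k != i), r k (m k) < r k y]].

Lemma above_minP i y :
  reflect (forall k, k != i -> r k (m k) < r k y) (y \in above_min i).
Proof. by rewrite inE; apply: forall_inP. Qed.

Definition top_above_min i :=
  [set y in above_min i | [forall z in above_min i, r i z <= r i y]].

Lemma top_above_minP i y :
  reflect (y \in above_min i /\ forall z, z \in above_min i -> r i z <= r i y)
          (y \in top_above_min i).
Proof.
apply: (iffP setIdP) => -[yA yM]; split=> //; exact/forall_inP.
Qed.

Lemma card_top_above_min i : #|top_above_min i| = (above_min i != set0).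
Proof.
have [A0|[y yA]] := set_0Vmem (above_min i).
  rewrite A0 eqxx; apply/eqP; rewrite cards_eq0; apply/eqP/setP => y.
  by rewrite inE A0 inE.
rewrite (_ : above_min i != set0); last by apply/set0Pn; exists y.
have [t tA tP] := @arg_maxnP _ y (mem (above_min i)) (r i) yA.
rewrite (_ : top_above_min i = [set t]) ?cards1 //.
apply/setP => z; rewrite inE; apply/top_above_minP/eqP => [[zA zP]|->] //.
apply: (@r_inj i); apply/eqP; rewrite eqn_leq zP // andbT; exact: tP.
Qed.

Lemma not_above_all y : ~ (forall k, r k (m k) < r k y).
Proof.
move=> yP; have /existsP[k /forall_inP kP] := forallP dB y.
by have := yP k; rewrite ltnNge kP.
Qed.

(** Adding [y] makes [y] the minimum for exactly one order, and the other
    minima must remain distinct; so that order is [i] or [j], the two that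
    share a minimum in [B].  Then domination of [y |: B] amounts to [y]
    being the largest candidate for that order. *)
Lemma completions_two_tops i j : i != j -> m i = m j ->
  (forall k l, k != l -> m k = m l ->
     (k \in [set i; j]) /\ (l \in [set i; j])) ->
  [set y | (y \notin B) && dominating (y |: B)]
    = top_above_min i :|: top_above_min j.
Proof.
move=> ij mij mP; apply/setP => y; rewrite [in LHS]inE [in RHS]inE.
apply/andP/orP => [[yB dyB]|yT].
  have cyB : #|y |: B| = #|I| by rewrite cardsU1 yB add1n.
  have yyB : y \in y |: B by rewrite setU11.
  have := imset_min_elt yyB dyB; set m' := min_elt (y |: B) y => m'P.
  have m'inj : injective m'.
    have /imset_injP m'I : #|m' @: [set: I]| == #|[set: I]|.
      by rewrite m'P cyB cardsT.
    by move=> k l; apply: m'I; rewrite inE.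
  have m'B k : m' k \in y |: B := (min_eltP yyB k).1.
  have m'_le k z : z \in y |: B -> r k (m' k) <= r k z :=
    (min_eltP yyB k).2 z.
  have : y \in m' @: [set: I] by rewrite m'P.
  move=> /imsetP[k0 _ yk0].
  have m'm k : k != k0 -> m' k = m k.
    move=> kk0; apply: min_elt_unique => //.
      have := m'B k; rewrite !inE => /orP[/eqP m'y|//].
      by case/eqP: kk0; apply: m'inj; rewrite m'y.
    by move=> z zB; apply: m'_le; rewrite !inE zB orbT.
  have k0ij : k0 \in [set i; j].
    apply/negPn/negP; rewrite !inE negb_or => /andP[k0i k0j].
    have : m' i = m' j by rewrite !m'm // eq_sym.
    by move=> /m'inj/eqP; apply/negP.
  have yA : y \in above_min k0.
    apply/above_minP => k kk0; rewrite -m'm // ltn_neqAle m'_le // andbT.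
    apply/negP => /eqP/r_inj m'y; case/eqP: kk0; apply: m'inj.
    by rewrite m'y.
  have yT : y \in top_above_min k0.
    apply/top_above_minP; split=> // z /above_minP zA.
    have /existsP[k /forall_inP kP] := forallP dyB z.
    have [kk0|kk0] := eqVneq k k0; first by rewrite -kk0 kP.
    by have := kP _ (m'B k); rewrite leqNgt (m'm k kk0) zA.
  by case/set2P: k0ij => <-; [left|right].
have {yT}[k kij yT] : exists2 k, k \in [set i; j] & y \in top_above_min k.
  by case: yT; [exists i|exists j]; rewrite // ?set21 ?set22.
have [/above_minP yA yM] := top_above_minP _ _ yT.
have ymk : r k y < r k (m k).
  have /existsP[l /forall_inP lP] := forallP dB y.
  have := lP _ (mB l); rewrite leqNgt.
  have [->|lk] := eqVneq l k; last by rewrite yA.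
  rewrite -leqNgt leq_eqVlt => /orP[/eqP/r_inj ym|//].
  (* [y] is then the common minimum of [i] and [j], but lies above one of the two *)
  have : exists2 l', l' != k & m l' = m k.
    case/set2P: kij => ->; first by exists j; rewrite // eq_sym.
    by exists i.
  by case=> l' l'k ml'; have := yA _ l'k; rewrite ml' ym ltnn.
split; first by apply/negP => /(m_le k); rewrite leqNgt ymk.
apply/forallP => z; apply/existsP.
have [zA|zA] := boolP (z \in above_min k).
  exists k; apply/forall_inP => w; rewrite !inE => /orP[/eqP->|/(m_le k)].
    exact: yM.
  by apply: leq_trans; apply: leq_trans (ltnW ymk); apply: yM.
have /exists_inP[l lk lP] : [exists (l | l != k), r l z <= r l (m l)].
  apply: contraNT zA; rewrite negb_exists_in => /forall_inP H.
  by apply/above_minP => l /H; rewrite -ltnNge.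
exists l; apply/forall_inP => w; rewrite !inE => /orP[/eqP->|/(m_le l)].
  exact: leq_trans lP (ltnW (yA _ lk)).
exact: leq_trans.
Qed.

Lemma disjoint_tops i j : i != j -> [disjoint top_above_min i & top_above_min j].
Proof.
move=> ij; rewrite -setI_eq0; apply/eqP/setP => y; rewrite inE [RHS]inE.
apply/negP => /andP[/top_above_minP[/above_minP yi _]
                    /top_above_minP[/above_minP yj _]].
apply: (@not_above_all y) => k.
by have [->|] := eqVneq k i; [exact: yj | exact: yi].
Qed.

Lemma card_completions : exists i j, [/\ i != j, m i = m j &
  #|[set y | (y \notin B) && dominating (y |: B)]|
    = (above_min i != set0) + (above_min j != set0)].
Proof.
have : #|m @: [set: I]|.+1 = #|[set: I]| by rewrite imset_min_elt // cardsT.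
move=> /one_collision[i [j [_ _ ij mij mP]]]; exists i, j; split=> //.
rewrite (completions_two_tops ij mij); last by move=> k l; apply: mP.
by rewrite cardsU disjoint_setI0 ?disjoint_tops // cards0 subn0 !card_top_above_min.
Qed.

End Completions.

Variable x0 : Z.
Hypotheses (x0_slack : x0 \notin codom e) (I_gt1 : 1 < #|I|).

Lemma slack_inj : injective e.
Proof.
move=> i j eij; apply/eqP/negPn/negP => ij.
by have := leq_ltn_trans (e_low i x0) (e_high ij x0_slack); rewrite eij ltnn.
Qed.

(** An element of [B] that is not slack lies below [e k] in all orders but
    that of [k], so [e k] is a candidate for [k] and both colliding orders
    yield a completion. *)
Lemma even_completions (B : {set Z}) b :
  b \in B -> b \notin codom e -> #|B|.+1 = #|I| ->
  ~~ odd #|[set y | (y \notin B) && dominating (y |: B)]|.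
Proof.
move=> bB bX cB; have [dB|dB] := boolP (dominating B); last first.
  rewrite (_ : [set _ | _] = set0) ?cards0 //; apply/setP => y; rewrite !inE.
  apply/negP => /andP[_]; apply/negP; apply: contra dB.
  exact/dominating_sub/subsetUr.
have [i [j [_ _ ->]]] := card_completions bB dB cB.
have above k : above_min B b k != set0.
  apply/set0Pn; exists (e k); apply/above_minP => l lk.
  exact: leq_ltn_trans ((min_eltP bB l).2 b bB) (e_high lk bX).
by rewrite !above.
Qed.

(** The boundary case of the parity count.  In the set of all slack
    elements but [e i0], every order other than that of [i0] has its own
    slack element as minimum; the minimum for [i0] is some [e j].  The
    candidates for [i0] include [x0], whereas there is none for [j]. *)
Lemma odd_completions i0 (B := e @: [set~ i0]) :
  #|[set y | (y \notin B) && dominating (y |: B)]| = 1.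
Proof.
have cB : #|B|.+1 = #|I|.
  rewrite card_imset; last exact: slack_inj.
  by rewrite cardsC1; case: #|I| I_gt1.
have [b bB] : exists b, b \in B.
  by apply/set0Pn; rewrite -card_gt0 -ltnS cB.
have BP z : z \in B -> exists2 j, j != i0 & z = e j.
  by case/imsetP => j; rewrite !inE => ji ->; exists j.
have eB j : j != i0 -> e j \in B by move=> ji; rewrite imset_f // !inE.
have dB : dominating B.
  apply/forallP => y; apply/existsP.
  have [/codomP[k ->]|yX] := boolP (y \in codom e).
    by exists k; apply/forall_inP => z _; apply: e_low.
  exists i0; apply/forall_inP => z /BP[j ji ->].
  by apply/ltnW/e_high; rewrite // eq_sym.
have mE k : k != i0 -> min_elt B b k = e k.
  by move=> /eB ekB; symmetry; apply: min_elt_unique => // z _; apply: e_low.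
have [i [j [ij mij ->]]] := card_completions bB dB cB.
wlog ii0 : i j ij mij / i = i0.
  move=> W; have [/W->//|ii0] := eqVneq i i0.
  have [ji0|ji0] := eqVneq j i0; first by rewrite addnC W // eq_sym.
  by move: mij; rewrite !mE // => /slack_inj/eqP; rewrite (negPf ij).
rewrite ii0 in ij mij *; rewrite eq_sym in ij; rewrite (mE j ij) in mij.
have -> : above_min B b i0 != set0.
  apply/set0Pn; exists x0; apply/above_minP => k ki0.
  rewrite mE // ltn_neqAle e_low andbT; apply: contra x0_slack => /eqP/r_inj <-.
  exact: codom_f.
suff -> : above_min B b j = set0 by rewrite eqxx.
apply/setP => y; rewrite [RHS]inE; apply/negP => /above_minP yA.
have [/codomP[k yk]|yX] := boolP (y \in codom e).
  have [kj|kj] := eqVneq k j.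
    by have := yA i0; rewrite eq_sym ij mij yk kj ltnn => /(_ isT).
  by have := yA k kj; rewrite yk ltnNge e_low.
have i0j : i0 != j by rewrite eq_sym.
by have := yA i0 i0j; rewrite mij ltnNge ltnW // e_high.
Qed.

Lemma card_fibers (S T : finType) (P : S -> T -> bool) :
  #|[set p : S * T | P p.1 p.2]| = \sum_x #|[set y | P x y]|.
Proof.
rewrite -sum1dep_card -(pair_big_dep xpredT P (fun _ _ => 1)) /=.
by apply: eq_bigr => x _; rewrite sum1dep_card.
Qed.

(** Count the pairs of a dominating [B] with [#|I|] elements and a [z] in
    [B] such that [B :\ z] carries all labels but [i0].  For fixed [B]
    their number is 0 or 2 unless [B] carries all labels; for fixed [B :\
    z] it is even, except for the set of slack elements without [e i0],
    where it is 1. *)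
Lemma scarf (c : Z -> I) : (forall i, c (e i) = i) ->
  exists B : {set Z}, dominating B /\ c @: B = [set: I].
Proof.
move=> ce; have [i0 _] : exists i, i \in I by apply/card_gt0P; exact: ltnW.
have [/existsP[B /andP[dB /eqP cB]]|] :=
  boolP [exists B : {set Z}, dominating B && (c @: B == [set: I])].
  by exists B.
rewrite negb_exists => /forallP none.
pose K : {set I} := [set~ i0].
have cK : #|K|.+1 = #|I| by rewrite cardsC1; case: #|I| I_gt1.
pose P (B : {set Z}) z :=
  [&& dominating B, #|B| == #|I|, z \in B & c @: (B :\ z) == K].
pose Q (B : {set Z}) y :=
  [&& #|B|.+1 == #|I|, c @: B == K, y \notin B & dominating (y |: B)].
have : #|[set p | P p.1 p.2]| = #|[set p | Q p.1 p.2]|.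
  rewrite -(card_in_imset (f := fun p => (p.1 :\ p.2, p.2))); last first.
    move=> [B z] [B' z']; rewrite !inE /= => /and4P[_ _ zB _] /and4P[_ _ zB' _].
    by move=> -[BB zz]; rewrite -(setD1K zB) BB zz setD1K.
  apply: eq_card => -[B y]; rewrite [RHS]inE /=; apply/imsetP/idP.
    move=> [[B' z]]; rewrite inE /= => /and4P[dB /eqP cB zB cD] [-> ->].
    by rewrite /Q cD setD1K // dB !inE eqxx -cB (cardsD1 z B') zB add1n eqxx.
  move=> /and4P[/eqP cB cD yB dB]; exists (y |: B, y); rewrite /= ?setU1K //.
  by rewrite inE /P /= dB cardsU1 yB add1n cB eqxx setU11 setU1K.
move/(congr1 odd); rewrite !card_fibers [in RHS](bigD1 (e @: K)) //= oddD.
have even_sum (F : {set Z} -> nat) (C : pred {set Z}) :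
    (forall B, C B -> ~~ odd (F B)) -> odd (\sum_(B | C B) F B) = false.
  move=> FC; apply/negbTE; elim/big_ind: _ => // x y.
  by rewrite oddD => /negPf-> /negPf->.
rewrite [X in X = _]even_sum; last first.
  move=> B _.
  have [->|[z]] := set_0Vmem [set y | P B y]; first by rewrite cards0.
  rewrite inE => /and4P[dB /eqP cB zB /eqP cD].
  have cBK : c @: B = K.
    apply/eqP; rewrite eqEsubset -{2}cD imsetS ?subsetDl // andbT.
    have := none B; rewrite dB /= => /eqP cBT.
    apply/subsetP => i iB; rewrite !inE; apply/negP => /eqP ii0; apply: cBT.
    apply/setP => j; rewrite inE; have [ji0|ji0] := eqVneq j i0.
      by rewrite ji0 -ii0.
    have : j \in K by rewrite !inE.
    by rewrite -cD; apply/subsetP/imsetS/subsetDl.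
  have := one_collision (f := c) (A := B); rewrite cBK cB => /(_ cK).
  move=> [k [l [kB lB kl ckl klP]]].
  suff -> : [set y | P B y] = [set k; l] by rewrite cards2 kl.
  apply/setP => y; rewrite inE; apply/and4P/idP.
    move=> [_ _ yB /eqP cy]; have : c y \in K by rewrite -cBK imset_f.
    rewrite -cy => /imsetP[w /setD1P[wy wB] cyw].
    by rewrite eq_sym in wy; have [] := klP y w yB wB wy cyw.
  move=> ykl; have yB : y \in B by case/set2P: ykl => ->.
  split; rewrite ?cB // -cBK; apply/eqP/setP => j.
  apply/imsetP/imsetP => -[w wB ->].
    by move: wB; rewrite !inE => /andP[_ wB]; exists w.
  have [->|wy] := eqVneq w y; last by exists w; rewrite // !inE wy.
  case/set2P: ykl => ->; first by exists l; rewrite // !inE eq_sym kl.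
  by exists k; rewrite // !inE kl.
rewrite even_sum ?addbF; last first.
  move=> B BK.
  have [->|[y]] := set_0Vmem [set y | Q B y]; first by rewrite cards0.
  rewrite inE => /and4P[/eqP cB /eqP cD _ _].
  have [/existsP[b /andP[bB bX]]|] :=
    boolP [exists b, (b \in B) && (b \notin codom e)].
    have := even_completions bB bX cB; congr (~~ odd _); apply: eq_card => z.
    by rewrite !inE /Q cB cD !eqxx.
  rewrite negb_exists => /forallP Bslack; case/eqP: BK.
  apply/setP => z; apply/idP/imsetP => [zB|[j jK ->]].
    have := Bslack z; rewrite zB /= negbK => /codomP[j zj]; exists j => //.
    by rewrite -cD -(ce j) -zj imset_f.
  move: jK; rewrite -cD => /imsetP[w wB jw].
  have := Bslack w; rewrite wB /= negbK => /codomP[k wk].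
  by rewrite jw wk ce -wk.
suff -> : [set y | Q (e @: K) y]
    = [set y | (y \notin e @: K) && dominating (y |: e @: K)].
  by rewrite odd_completions.
apply/setP => y; rewrite !inE /Q card_imset ?cK ?eqxx /=; last exact: slack_inj.
suff -> : c @: (e @: K) = K by rewrite eqxx.
rewrite -imset_comp; apply/setP => j; apply/imsetP/idP => [[k kK ->]|jK].
  by rewrite /= ce.
by exists j; rewrite //= ce.
Qed.

End Scarf.

(** * Labellings of the lattice points of a simplex *)

Lemma slack_arith M m u c a v w n :
  M < m + u + c -> u <= v -> c <= n -> a + v + w = M -> a <= m + n.
Proof. lia. Qed.

Section Lattice.
Variables (I : finType) (M : nat).

(** Barycentric coordinates with denominator [M], scaled by [M]. *)
Definition lattice_point := {g : {ffun I -> 'I_M.+1} | \sum_i g i == M :> nat}.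

Definition bary (x : lattice_point) (i : I) : nat := val x i.

Lemma bary_sum x : \sum_i bary x i = M.
Proof. exact/eqP/(valP x). Qed.

Lemma bary_le x i : bary x i <= M.
Proof. by rewrite -ltnS ltn_ord. Qed.

Lemma mk_lattice_point (f : I -> nat) :
  \sum_i f i = M -> exists x, forall i, bary x i = f i.
Proof.
move=> fM; have f_le i : f i < M.+1 by rewrite ltnS -fM (bigD1 i) //= leq_addr.
have gP : \sum_i [ffun i => Ordinal (f_le i)] i == M :> nat.
  by rewrite -[X in _ == X]fM; apply/eqP/eq_bigr => i _; rewrite ffunE.
by exists (exist _ [ffun i => Ordinal (f_le i)] gP : lattice_point) => i; rewrite /bary /= ffunE.
Qed.

Let N := #|{: lattice_point}|.

(** The order of [i] compares the coordinate of index [i], ties being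
    broken by an arbitrary enumeration. *)
Definition rank (i : I) (z : lattice_point + I) : nat :=
  match z with
  | inl x => (bary x i * N + enum_rank x).+1
  | inr j => if j == i then 0 else (M.+1 * N + enum_rank j).+1
  end.

Lemma rank_lt i x : bary x i * N + enum_rank x < (bary x i).+1 * N.
Proof. by rewrite mulSn addnC ltn_add2r ltn_ord. Qed.

Lemma rank_bound i x : bary x i * N + enum_rank x < M.+1 * N.
Proof. by apply: leq_trans (rank_lt i x) _; rewrite leq_mul2r ltnS bary_le orbT. Qed.

Lemma rank_inj i : injective (rank i).
Proof.
move=> [x|j] [y|k] /=.
- move=> /succn_inj/(congr1 (modn^~ N)); rewrite /= !modnMDl !modn_small //.
  by move=> /val_inj/enum_rank_inj ->.
- case: eqP => // _ [E]; have := rank_bound i x; rewrite E.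
  by rewrite ltnNge leq_addr.
- case: eqP => // _ [E]; have := rank_bound i y; rewrite -E.
  by rewrite ltnNge leq_addr.
- case: eqP => [->|_]; case: eqP => [->|_] //.
  by move=> /succn_inj/addnI/val_inj/enum_rank_inj ->.
Qed.

Lemma rank_low i z : rank i (inr i) <= rank i z.
Proof. by rewrite /= eqxx. Qed.

Lemma rank_high (i j : I) (z : lattice_point + I) :
  i != j -> z \notin codom inr -> rank i z < rank i (inr j).
Proof.
case: z => [x|k] ij; last by rewrite codom_f.
move=> _; rewrite /= eq_sym (negPf ij) ltnS.
exact: leq_trans (rank_bound i x) (leq_addr _ _).
Qed.

Lemma bary_le_rank i x y : rank i (inl x) <= rank i (inl y) ->
  bary x i <= bary y i.
Proof.
rewrite /= ltnS => xy; rewrite -ltnS.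
have N_gt0 : 0 < N by apply/card_gt0P; exists x.
rewrite -(ltn_pmul2r N_gt0); apply: leq_ltn_trans (rank_lt i y).
exact: leq_trans (leq_addr _ _) xy.
Qed.

Hypothesis I_gt1 : 1 < #|I|.

(** In a dominating set with all labels, let [C] be the indices whose
    slack element is absent, and [m] the coordinatewise minimum over the
    lattice points of the set.  If the [m i + 1], for [i] in [C], added up
    to at most [M], some lattice point would exceed [m] in all coordinates
    of [C], against domination.  So the [m i] nearly exhaust [M]: all
    lattice points of the set agree up to [#|I|], and their coordinates
    outside [C] are at most [#|I|]. *)
Lemma small_labelled_cell (c : lattice_point -> I) :
  exists x : lattice_point, forall i, exists y : lattice_point,
    (forall j, bary y j <= bary x j + #|I| /\ bary x j <= bary y j + #|I|)
    /\ (c y = i \/ y = x /\ bary x i <= #|I|).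
Proof.
have /card_gt0P[i0 _] := ltnW I_gt1.
have [x0 _] : exists x, forall i, bary x i = if i == i0 then M else 0.
  apply: mk_lattice_point; rewrite (bigD1 i0) //= eqxx big1 ?addn0 //.
  by move=> i /negPf ->.
pose c' (z : lattice_point + I) := match z with inl x => c x | inr i => i end.
have x0X : (inl x0 : lattice_point + I) \notin codom (@inr lattice_point I).
  by apply/negP => /codomP[].
have [B [/forallP dB cB]] :=
  scarf rank_inj rank_low rank_high x0X I_gt1 (c := c') (fun=> erefl).
have domB y : exists2 i, inr i \notin B &
    forall x, inl x \in B -> bary y i <= bary x i.
  have /existsP[i /forall_inP iB] := dB (inl y); exists i.
    by apply/negP => /iB; rewrite /= eqxx.
  by move=> x /iB; apply: bary_le_rank.
have labB i : inr i \notin B -> exists2 x, inl x \in B & c x = i.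
  move=> iB; have : i \in c' @: B by rewrite cB inE.
  case/imsetP => -[x xB ->|j jB /= ij]; first by exists x.
  by rewrite -ij (negPf iB) in jB.
have [i1 i1B _] := domB x0; have [g0 g0B _] := labB i1 i1B.
pose D := [set x | inl x \in B].
have Dg0 : g0 \in D by rewrite inE.
pose m i := bary [arg min_(x < g0 in D) bary x i] i.
have m_le i x : inl x \in B -> m i <= bary x i.
  by move=> xB; rewrite /m; case: arg_minnP => // y _; apply; rewrite inE.
have m_dom y : exists2 i, inr i \notin B & bary y i <= m i.
  have [i iB yB] := domB y; exists i => //; rewrite /m.
  by case: arg_minnP => // x; rewrite inE => /yB.
pose C := [set i | inr i \notin B].
have CE i : (i \in C) = (inr i \notin B) by rewrite inE.
have M_lt : M < \sum_(i in C) (m i).+1.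
  rewrite ltnNge; apply/negP => le_M.
  set s := \sum_(i in C) _ in le_M.
  (* the excess [M - s] is put on an arbitrary coordinate of [C] *)
  pose f i := if i \in C then (m i).+1 + (i == i1) * (M - s) else 0.
  have [|y yf] := @mk_lattice_point f.
    rewrite /f -big_mkcond big_split /= -/s (bigD1 i1) ?CE //= eqxx mul1n.
    rewrite big1 ?addn0 ?subnKC // => i /andP[_ /negPf ->] //.
  have [i iB] := m_dom y; rewrite yf /f CE iB leqNgt; apply/negP/negPn.
  by rewrite addSn ltnS leq_addr.
have slack x : inl x \in B ->
    forall i, bary x i <= (if i \in C then m i else 0) + #|I|.
  move=> xB i; have := bary_sum x; rewrite (bigID (mem C)) /= => xM.
  have m_sum : \sum_(i in C) m i <= \sum_(i in C) bary x i.
    by apply: leq_sum => j _; apply: m_le.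
  move: M_lt; under eq_bigr do rewrite -addn1; rewrite big_split /= sum1_card.
  have CI : #|C| <= #|I| := max_card _.
  case: ifPn => iC.
    rewrite (bigD1 i) //= in xM.
    have m_sum' : \sum_(j in C | j != i) m j <= \sum_(j in C | j != i) bary x j.
      by apply: leq_sum => j _; apply: m_le.
    rewrite (bigD1 i) //= => M_lt.
    exact: slack_arith M_lt m_sum' CI xM.
  rewrite [X in _ + X = _](bigD1 i) //= addnCA addnA in xM => M_lt.
  exact: (slack_arith (m := 0) M_lt m_sum CI xM).
have near x y : inl x \in B -> inl y \in B ->
    forall j, bary y j <= bary x j + #|I|.
  move=> xB yB j; apply: leq_trans (slack y yB j) _.
  by rewrite leq_add2r; case: ifP => // _; apply: m_le.
exists g0 => i; have [iC|iC] := boolP (i \in C).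
  have [|y yB cy] := labB i; first by rewrite -CE.
  by exists y; split; [move=> j; split; apply: near | left].
exists g0; split; first by move=> j; split; apply: near.
by right; split=> //; have := slack g0 g0B i; rewrite (negPf iC).
Qed.

End Lattice.

From mathcomp Require Import all_order all_algebra.
From mathcomp Require Import all_classical all_reals all_analysis.
From mathcomp Require Import ring lra.

Import Order.TTheory GRing.Theory Num.Theory.
Import numFieldNormedType.Exports.

Local Open Scope classical_set_scope.
Local Open Scope ring_scope.

(** * Limits along an ultrafilter and the Brouwer theorem on a simplex *)

Lemma cvg_finsum (R : realType) (I : finType) (A : Type) (F : set_system A)
    (FF : Filter F) (x : A -> I -> R) (l : I -> R) :
  (forall i, x a i @[a --> F] --> l i) ->
  \sum_i x a i @[a --> F] --> \sum_i l i.
Proof. by move=> xl; apply: cvg_big => //; exact: add_continuous. Qed.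

Lemma cvg_max (R : realType) (A : Type) (F : set_system A) (FF : Filter F)
    (x y : A -> R) (k l : R) :
  x a @[a --> F] --> k -> y a @[a --> F] --> l ->
  Num.max (x a) (y a) @[a --> F] --> Num.max k l.
Proof.
by move=> xk yl; apply: (continuous2_cvg _ _ xk yl); exact: (@max_continuous _ R (k, l)).
Qed.

Lemma cvg_min (R : realType) (A : Type) (F : set_system A) (FF : Filter F)
    (x y : A -> R) (k l : R) :
  x a @[a --> F] --> k -> y a @[a --> F] --> l ->
  Num.min (x a) (y a) @[a --> F] --> Num.min k l.
Proof.
by move=> xk yl; apply: (continuous2_cvg _ _ xk yl); exact: (@min_continuous _ R (k, l)).
Qed.

Definition ulim (R : realType) (U : set_system nat) (x : nat -> R) : R :=
  lim (x n @[n --> U]).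

(** A cluster point in a compact interval is a limit: the ultrafilter
    contains the preimage of each neighbourhood or the complement of that
    preimage. *)
Lemma ulim_cvg (R : realType) (U : set_system nat) (x : nat -> R) (b : R) :
  UltraFilter U -> (\forall n \near U, `|x n| <= b) ->
  x n @[n --> U] --> ulim U x.
Proof.
move=> UU xb; have UP := @ultra_proper _ _ UU.
have xU : (x @ U) `[- b, b]%classic.
  by apply: filterS xb => n /=; rewrite in_itv /= -ler_norml.
have [p [_ px]] := segment_compact (fmap_proper_filter x UP) xU.
suff : x n @[n --> U] --> (p : R) by exact: cvgP.
move=> V pV.
have [//|xV] := in_ultra_setVsetC (x @^-1` V) UU.
by have [z [nVz Vz]] := px (~` V) V xV pV.
Qed.

Lemma free_ultrafilter :
  exists U : set_system nat, UltraFilter U /\ \oo `<=` U.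
Proof. by apply: ultraFilterLemma. Qed.

Definition simplex (R : realType) (I : finType) : set (I -> R) :=
  [set x | (forall i, 0 <= x i) /\ \sum_i x i = 1].

(** Continuity for the product topology, tested along filters on the
    integers; for finite [I] this is ordinary continuity on [D], and it
    covers both sequences and ultrafilters. *)
Definition coordwise_continuous (R : realType) (I : finType) (D : set (I -> R))
    (T : (I -> R) -> I -> R) :=
  forall F : set_system nat, ProperFilter F ->
  forall (x : nat -> I -> R) (l : I -> R), (forall n, D (x n)) -> D l ->
    (forall i, x n i @[n --> F] --> l i) ->
  forall i, T (x n) i @[n --> F] --> T l i.

(** Label a lattice point [x] by an index whose coordinate [T] does not
    decrease; one exists because coordinates of [x] and of [T x] have the
    same sum.  At an index missing from the labels of a small cell, the
    coordinate itself is small. *)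
Lemma approximate_fixpoint (R : realType) (I : finType) (T : (I -> R) -> I -> R)
    (M : nat) : (1 < #|I|)%N ->
  (forall x, simplex x -> simplex (T x)) ->
  exists (x : I -> R) (y : I -> I -> R), simplex x /\ forall i,
    [/\ simplex (y i), forall j, `|y i j - x j| <= #|I|%:R / M.+1%:R
      & y i i <= T (y i) i + #|I|%:R / M.+1%:R].
Proof.
move=> I1 TS; set d := #|I|%:R / _.
have /card_gt0P[i0 _] := ltnW I1.
have M0 : 0 < M.+1%:R :> R by rewrite ltr0n.
pose pt (g : lattice_point I M.+1) i : R := (bary g i)%:R / M.+1%:R.
have ptS g : simplex (pt g).
  split=> [i|]; first by rewrite divr_ge0.
  by rewrite -mulr_suml -natr_sum bary_sum divff // gt_eqF.
have ex_lab g : exists i, pt g i <= T (pt g) i.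
  apply/not_existsP => H; have [_ s1] := ptS g; have [_ s2] := TS _ (ptS g).
  have : \sum_i T (pt g) i < \sum_i pt g i.
    apply: ltr_sum; first by apply/hasP; exists i0; rewrite ?mem_index_enum.
    by move=> i _; rewrite ltNge; apply/negP/H.
  by rewrite s1 s2 ltxx.
have [c cP] := choice ex_lab.
have [g gP] := small_labelled_cell I1 c.
have [h hP] := choice gP.
exists (pt g), (pt \o h); split=> // i; have [near hi] := hP i.
split=> [||/=]; first exact: ptS.
  move=> j; rewrite /pt -mulrBl normf_div normr_nat.
  rewrite /d ler_pM2r ?invr_gt0 //; have [n1 n2] := near j.
  by rewrite ler_distlC lerBlDr -!natrD !ler_nat n1 n2.
have d0 : 0 <= d by rewrite divr_ge0.
case: hi => [ci|[-> gi]].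
  by have := cP (h i); rewrite ci => /le_trans; apply; rewrite lerDl.
have [T0 _] := TS _ (ptS g); apply: ler_wpDl => //.
by rewrite /pt /d ler_pM2r ?invr_gt0 // ler_nat.
Qed.

(** Along a free ultrafilter the small cells shrink to one point [l], with
    [l i <= T l i] for all [i]; both sides have sum 1. *)
Lemma brouwer_simplex (R : realType) (I : finType) (T : (I -> R) -> I -> R) :
  (1 < #|I|)%N -> (forall x, simplex x -> simplex (T x)) ->
  coordwise_continuous (@simplex R I) T ->
  exists2 x, simplex x & T x = x.
Proof.
move=> I1 TS Tc.
have := fun M => approximate_fixpoint M I1 TS.
move=> /choice[x] /choice[y] xyP.
have [U [UU freeU]] := free_ultrafilter; have UP := @ultra_proper _ _ UU.
have dU : #|I|%:R / M.+1%:R @[M --> U] --> (0 : R).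
  rewrite -[X in _ --> X](mulr0 #|I|%:R).
  by apply: cvgMl_tmp; apply: cvg_trans cvg_harmonic; exact: cvg_fmap2.
have xb i M : `|x M i| <= 1.
  have [[x0 x1] _] := xyP M; rewrite ger0_norm // -x1 (bigD1 i) //= lerDl.
  exact: sumr_ge0.
have [l xl] : exists l : I -> R, forall i, x M i @[M --> U] --> l i.
  by exists (fun i => ulim U (x ^~ i)) => i; apply: ulim_cvg (nearW _ (xb i)).
have lS : simplex l.
  split=> [i|].
    apply: (cvgr_to_ge (xl i)); near=> M; by have [[x0 _] _] := xyP M.
  apply: (cvg_unique (@Rhausdorff R) (cvg_finsum _ xl)).
  rewrite (_ : (fun M => _) = fun=> 1); first exact: cvg_cst.
  by apply/funext => M; have [[]] := xyP M.
have yl i j : y M i j @[M --> U] --> l j.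
  rewrite -[l j]addr0 (_ : (fun M => _) = (fun M => x M j + (y M i j - x M j))).
    apply: cvgD; first exact: xl.
    apply/cvgr0Pnorm_le => e e0.
    move/cvgr0Pnorm_le : dU => /(_ e e0); apply: filterS => M.
    rewrite ger0_norm ?divr_ge0 //; apply: le_trans.
    by have [_ /(_ i)[]] := xyP M.
  by apply/funext => M; rewrite addrC subrK.
have l_le i : l i <= T l i.
  have Ty : T (y M i) i @[M --> U] --> T l i.
    by apply: Tc => // M; have [_ /(_ i)[]] := xyP M.
  apply: (ler_cvg_to (yl i i) (g := fun M => T (y M i) i + #|I|%:R / M.+1%:R)).
    by rewrite -[T l i]addr0; apply: cvgD.
  by near=> M; have [_ /(_ i)[]] := xyP M.
exists l => //; apply/funext => i; apply/eqP; rewrite -subr_eq0.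
have : \sum_i (T l i - l i) == 0.
  by rewrite sumrB; have [_ ->] := TS _ lS; have [_ ->] := lS; rewrite subrr.
rewrite psumr_eq0 => [/allP/(_ i)|j _]; last by rewrite subr_ge0.
by rewrite mem_index_enum => /(_ isT).
Unshelve. all: by end_near. Qed.

(** * Compression and expansion on an orthant *)

Lemma sum_option (R : nmodType) (I : finType) (F : option I -> R) :
  \sum_o F o = F None + \sum_i F (Some i).
Proof.
rewrite (bigD1 None) //=; congr (_ + _).
rewrite (reindex_omap Some id) => [|[]//].
by apply: eq_bigl => i; rewrite /= eqxx.
Qed.

Definition orthant (R : realType) (I : finType) : set (I -> R) :=
  [set g | forall i, 0 <= g i].

Section Krasnoselskii.
Variables (R : realType) (I : finType) (c : I -> R).
Variables (S : (I -> R) -> I -> R) (p q : R).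

Definition weight (g : I -> R) := \sum_i c i * g i.

Hypotheses (I_gt0 : (0 < #|I|)%N) (c_gt0 : forall i, 0 < c i).
Hypotheses (p_gt0 : 0 < p) (q_gt0 : 0 < q).
Hypothesis S_ge0 : forall g, orthant g -> orthant (S g).
Hypothesis S_cont : coordwise_continuous (@orthant R I) S.
Hypothesis S_gt0 : forall g, orthant g -> 0 < weight (S g).
Hypothesis S_p : forall g, orthant g -> weight g = p -> p < weight (S g).
Hypothesis S_q : forall g, orthant g -> weight g = q -> weight (S g) < q.

Let mass (y : option I -> R) := \sum_i y (Some i).
(* Below mass 1/2 the radius is frozen and the point shrinks linearly to 0,
   which keeps the map continuous where no direction is defined; since the
   new mass is at least 1/2, fixed points avoid that region. *)
Let radial (y : option I -> R) := Num.max (1 / 2) (mass y).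
Let radius (y : option I -> R) := p + (q - p) * (2 * radial y - 1).
Let point (y : option I -> R) i := radius y * y (Some i) / (c i * radial y).
Let new_mass y := Num.max (1 / 2)
  (Num.min 1 (mass y + (weight (S (point y)) - radius y))).
Let selfmap y o :=
  match o with
  | None => 1 - new_mass y
  | Some i => new_mass y * (c i * S (point y) i / weight (S (point y)))
  end.

Let mass_le1 y : simplex y -> mass y <= 1.
Proof. by move=> [y0]; rewrite sum_option -/(mass y) => <-; rewrite lerDr. Qed.

Let radial_bounds y : simplex y -> 1 / 2 <= radial y <= 1.
Proof.
by move=> /mass_le1 y1; rewrite /radial le_max lexx ge_max y1 andbT /=; lra.
Qed.

Let radius_bounds y : simplex y -> Num.min p q <= radius y <= Num.max p q.
Proof.
move=> /radial_bounds; rewrite /radius; set m := radial y => m1.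
by rewrite /Num.min /Num.max; case: ltP => pq; nra.
Qed.

Let radius_gt0 y : simplex y -> 0 < radius y.
Proof.
move=> /radius_bounds/andP[+ _]; apply: lt_le_trans.
by rewrite lt_min p_gt0.
Qed.

Let point_ge0 y : simplex y -> orthant (point y).
Proof.
move=> yS i; have [y0 _] := yS; have := radial_bounds yS => m1.
have r0 : 0 < radial y by lra.
apply: divr_ge0; first exact: (mulr_ge0 (ltW (radius_gt0 yS)) (y0 _)).
exact: (mulr_ge0 (ltW (c_gt0 i)) (ltW r0)).
Qed.

Let new_mass_bounds y : 1 / 2 <= new_mass y <= 1.
Proof. by rewrite /new_mass le_max lexx ge_max ge_min lexx andbT /=; lra. Qed.

Let weight_point y : simplex y -> weight (point y) = radius y * mass y / radial y.
Proof.
move=> yS; have := radial_bounds yS => m1.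
rewrite /weight /mass mulr_sumr mulr_suml; apply: eq_bigr => i _.
rewrite /point; have := c_gt0 i => ci0; field; apply/andP; split; lra.
Qed.

Let selfmap_simplex y : simplex y -> simplex (selfmap y).
Proof.
move=> yS; have := new_mass_bounds y => m1.
have W0 := S_gt0 (point_ge0 yS); split.
  case=> [i|] /=; last lra.
  have := S_ge0 (point_ge0 yS) i => Si.
  apply: mulr_ge0; first lra.
  by apply: divr_ge0 (ltW W0); apply: mulr_ge0 (ltW (c_gt0 i)) Si.
rewrite sum_option /= -mulr_sumr -mulr_suml -/(weight _) divff ?gt_eqF //.
by rewrite mulr1 subrK.
Qed.

Let selfmap_cont : coordwise_continuous (@simplex R (option I)) selfmap.
Proof.
move=> F FP y l yS lS yl.
have mass_c : mass (y n) @[n --> F] --> mass l.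
  by apply: cvg_finsum => i; apply: yl.
have radial_c : radial (y n) @[n --> F] --> radial l.
  by apply: cvg_max => //; apply: cvg_cst.
have radius_c : radius (y n) @[n --> F] --> radius l.
  apply: cvgD; first exact: cvg_cst.
  apply: cvgMl_tmp; apply: cvgB; last exact: cvg_cst.
  exact: cvgMl_tmp.
have point_c i : point (y n) i @[n --> F] --> point l i.
  apply: cvgM; first by apply: cvgM => //; apply: yl.
  apply: cvgV; last exact: cvgMl_tmp.
  have := radial_bounds lS => m1.
  by rewrite mulf_neq0 ?gt_eqF //; lra.
have S_c i : S (point (y n)) i @[n --> F] --> S (point l) i.
  by apply: S_cont => // [n|]; apply: point_ge0.
have W_c : weight (S (point (y n))) @[n --> F] --> weight (S (point l)).
  by apply: cvg_finsum => i; apply: cvgMl_tmp.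
have new_c : new_mass (y n) @[n --> F] --> new_mass l.
  apply: cvg_max; first exact: cvg_cst.
  apply: cvg_min; first exact: cvg_cst.
  by apply: cvgD => //; apply: cvgB.
case=> [i|] /=; last by apply: cvgB => //; apply: cvg_cst.
apply: cvgM => //; apply: cvgM; first exact: cvgMl_tmp.
by apply: cvgV => //; rewrite gt_eqF // S_gt0 //; apply: point_ge0.
Qed.

(** The simplex on [option I] carries a direction (the coordinates in [I],
    normalised) and a mass (their sum).  The mass in [1/2, 1] parametrises
    affinely the weights between [p] (at 1/2) and [q] (at 1), increasingly
    or decreasingly.  The self-map replaces the direction by that of the
    image under [S], and moves the mass by the change of weight, clipped
    to [1/2, 1]; at a fixed point the clipping is inactive by the
    hypotheses at [p] and [q], so that the weight is unchanged too. *)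
Theorem krasnoselskii_orthant : exists g,
  [/\ orthant g, S g = g & Num.min p q <= weight g <= Num.max p q].
Proof.
have I1 : (1 < #|{: option I}|)%N by rewrite card_option ltnS.
have [y yS yE] := brouwer_simplex I1 selfmap_simplex selfmap_cont.
have g0 := point_ge0 yS; set g := point y in g0.
have W0 := S_gt0 g0; set W := weight (S g) in W0.
have massE : mass y = new_mass y.
  have := congr1 (fun z => 1 - z None) yE => /=.
  have [_ y1] := yS; rewrite sum_option -/(mass y) in y1.
  by rewrite subKr => ->; lra.
have := new_mass_bounds y; rewrite -massE => mass_bd.
have radialE : radial y = mass y by rewrite /radial; apply/max_idPr; lra.
have gE : weight g = radius y.
  rewrite weight_point // radialE mulfK // gt_eqF //; lra.
have WE : W = radius y.
  have := massE; rewrite /new_mass -/g -/W.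
  have := S_p g0; have := S_q g0; rewrite -/W gE /radius radialE.
  set m := mass y in mass_bd * => Sq Sp; set r := p + _ in Sq Sp *.
  have rE : r = p + (q - p) * (2 * m - 1) by [].
  (* a discrepancy would force the mass to an end point, where the weight
     changes in the opposite direction *)
  have [wr|wr|//] := ltgtP W r.
    have wr' : W - r < 0 by lra.
    rewrite min_r; last by lra.
    rewrite /Num.max; case: ifPn => _ mE; first by lra.
    by have : r = p by [rewrite rE mE; field]; move=> /[dup]/Sp; lra.
  rewrite /Num.min; case: ifPn => _.
    rewrite max_r => [mE|]; last by lra.
    by have : r = q by [rewrite rE mE; field]; move=> /[dup]/Sq; lra.
  by rewrite max_r; lra.
exists g; split=> //; last by rewrite gE radius_bounds.
apply/funext => i.
have -> : g i = radius y * y (Some i) / (c i * mass y).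
  by rewrite /g /point radialE.
have := congr1 (fun z => z (Some i)) yE => /= <-; rewrite -massE -/g -/W WE.
have r0 := radius_gt0 yS; have := c_gt0 i => ci.
field; rewrite !gt_eqF //; lra.
Qed.

End Krasnoselskii.

(** * The Green function of the three-point problem *)

Section Green.
Variables (R : realType) (eta alpha : R).

Definition ramp (x : R) := Num.max x 0.

(** The value at 0 of the [t]-derivative of the Green function with pole
    [s]; it is fixed by the three-point condition. *)
Definition slope (s : R) := (1 - s - alpha * ramp (eta - s)) / (1 - alpha * eta).

Definition green (t s : R) := t * slope s - ramp (t - s).

(** The primitive of the Green function in [t]. *)
Definition green_int (t s : R) := t ^+ 2 / 2 * slope s - ramp (t - s) ^+ 2 / 2.

(** The last inequality is [alpha < 1 / eta], the solvability condition of
    the three-point problem in the form of a positive denominator. *)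
Definition three_point_data :=
  [/\ 0 < eta, eta < 1, 1 < alpha & 0 < 1 - alpha * eta].

Hypothesis dataP : three_point_data.

Definition slope_rate := (alpha - 1) / (1 - alpha * eta).

Lemma slope_rate_ge0 : 0 <= slope_rate.
Proof.
have [eta_gt0 eta_lt1 alpha_gt1 kappa_gt0] := dataP.
by rewrite /slope_rate divr_ge0 ?subr_ge0 ?ltW // -subr_gt0. Qed.

Lemma kappa_lt : 1 - alpha * eta < 1 - eta.
Proof.
have [eta_gt0 eta_lt1 alpha_gt1 kappa_gt0] := dataP.
by rewrite ltrD2l ltrN2 ltr_pMl. Qed.

Lemma ramp_pos (x : R) : 0 <= x -> ramp x = x.
Proof. by move=> x0; apply/max_idPl. Qed.

Lemma ramp_neg (x : R) : x <= 0 -> ramp x = 0.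
Proof. by move=> x0; apply/max_idPr. Qed.

Lemma slope_left s : s <= eta -> slope s = 1 + slope_rate * s.
Proof.
have [eta_gt0 eta_lt1 alpha_gt1 kappa_gt0] := dataP.
by move=> s1; rewrite /slope ramp_pos ?subr_ge0 // /slope_rate; field; rewrite gt_eqF.
Qed.

Lemma slope_right s : eta <= s -> slope s = (1 - s) / (1 - alpha * eta).
Proof.
have [eta_gt0 eta_lt1 alpha_gt1 kappa_gt0] := dataP.
by move=> s1; rewrite /slope ramp_neg ?subr_le0 // mulr0 subr0. Qed.

Lemma le_divk (x : R) : 0 <= x -> x / (1 - eta) <= x / (1 - alpha * eta).
Proof.
have [eta_gt0 eta_lt1 alpha_gt1 kappa_gt0] := dataP.
move=> x0; have e1 : 0 < 1 - eta by lra.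
by apply: ler_wpM2l => //; rewrite lef_pV2 ?posrE // ltW // kappa_lt.
Qed.

Lemma quotient_ge0 (s : R) : s <= 1 -> 0 <= (1 - s) / (1 - alpha * eta).
Proof.
have [eta_gt0 eta_lt1 alpha_gt1 kappa_gt0] := dataP.
by move=> s1; rewrite divr_ge0 ?subr_ge0 // -subr_ge0 ltW. Qed.

Lemma slope_ge0 (s : R) : 0 <= s <= 1 -> 0 <= slope s.
Proof.
have [eta_gt0 eta_lt1 alpha_gt1 kappa_gt0] := dataP.
move=> s1; have [se|/ltW se] := leP s eta.
  rewrite slope_left //; have := mulr_ge0 slope_rate_ge0 (proj1 (andP s1)); lra.
by rewrite slope_right // quotient_ge0 //; lra.
Qed.

Lemma slope_le (s : R) : 0 <= s <= 1 -> slope s <= (1 - alpha * eta)^-1.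
Proof.
have [eta_gt0 eta_lt1 alpha_gt1 kappa_gt0] := dataP.
move=> s1; rewrite /slope -[leRHS]mul1r ler_pM2r ?invr_gt0 //.
have : 0 <= alpha * ramp (eta - s).
  by rewrite mulr_ge0 // ?le_max ?lexx ?orbT //; lra.
lra.
Qed.

Lemma green_eta_left s : s <= eta -> green eta s = s * (1 + eta * slope_rate).
Proof.
have [eta_gt0 eta_lt1 alpha_gt1 kappa_gt0] := dataP.
by move=> se; rewrite /green slope_left // ramp_pos ?subr_ge0 //; ring.
Qed.

Lemma green_eta_right s :
  eta <= s -> green eta s = eta * ((1 - s) / (1 - alpha * eta)).
Proof.
have [eta_gt0 eta_lt1 alpha_gt1 kappa_gt0] := dataP.
by move=> se; rewrite /green slope_right // ramp_neg ?subr_le0 // subr0.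
Qed.

Lemma green_eta_gt0 (s : R) : 0 < s < 1 -> 0 < green eta s.
Proof.
have [eta_gt0 eta_lt1 alpha_gt1 kappa_gt0] := dataP.
move=> s1; have [se|/ltW se] := leP s eta.
  rewrite green_eta_left // mulr_gt0 //; first lra.
  have := mulr_ge0 (ltW eta_gt0) slope_rate_ge0; lra.
have s1' : 0 < 1 - s by lra.
by rewrite green_eta_right // mulr_gt0 // divr_gt0.
Qed.

Lemma green_eta_le (s : R) : 0 <= s <= 1 -> green eta s <= (1 - alpha * eta)^-1.
Proof.
have [eta_gt0 eta_lt1 alpha_gt1 kappa_gt0] := dataP.
move=> s1; apply: le_trans (slope_le s1); rewrite /green.
have r0 : 0 <= ramp (eta - s) by rewrite le_max lexx orbT.
have := slope_ge0 s1; nra.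
Qed.

(** As a function of [t] the Green function is concave, vanishes at 0 and
    takes at 1 a value above that at [eta]. *)
Lemma green_ge (t s : R) : 0 <= t <= 1 -> 0 <= s <= 1 -> t * green eta s <= green t s.
Proof.
have [eta_gt0 eta_lt1 alpha_gt1 kappa_gt0] := dataP.
move=> t1 s1; have b0 := slope_rate_ge0; have [se|/ltW se] := leP s eta.
  have bs0 : 0 <= slope_rate * s by rewrite mulr_ge0 //; lra.
  rewrite green_eta_left // /green slope_left //.
  rewrite (_ : s * _ = s + eta * (slope_rate * s)); last by ring.
  set bs := slope_rate * s in bs0 *.
  have ebs : eta * bs <= bs by nra.
  have [ts|/ltW ts] := leP t s.
    rewrite ramp_neg ?subr_le0 // subr0 ler_wpM2l //; lra.
  rewrite ramp_pos ?subr_ge0 //.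
  have : t * (eta * bs) <= t * bs by rewrite ler_wpM2l //; lra.
  have : 0 <= s * (1 - t) by rewrite mulr_ge0 //; lra.
  lra.
rewrite green_eta_right // /green slope_right //.
set a := (1 - s) / _; have a0 : 0 <= a by apply: quotient_ge0; lra.
have [ts|/ltW ts] := leP t s.
  rewrite ramp_neg ?subr_le0 // subr0 ler_wpM2l //; first lra.
  by rewrite ler_piMl // ltW.
rewrite ramp_pos ?subr_ge0 //.
have : 1 - s <= a * (1 - eta).
  have /le_divk : 0 <= 1 - s by lra.
  by rewrite -/a ler_pdivrMr //; lra.
move=> aP.
have : t * (1 - s) <= t * (a * (1 - eta)) by rewrite ler_wpM2l //; lra.
have : 0 <= s * (1 - t) by rewrite mulr_ge0 //; lra.
lra.
Qed.

(** By concavity the graph stays below the ray from the origin through its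
    point at [eta] to the right of [eta], and below its value at [eta] to
    the left, since the value at 1 is larger. *)
Lemma green_le (t s : R) : 0 <= t <= 1 -> 0 <= s <= 1 -> green t s <= green eta s / eta.
Proof.
have [eta_gt0 eta_lt1 alpha_gt1 kappa_gt0] := dataP.
move=> t1 s1; have b0 := slope_rate_ge0; rewrite ler_pdivlMr //.
have [se|/ltW se] := leP s eta.
  rewrite green_eta_left // /green slope_left //.
  have bs0 : 0 <= slope_rate * s by rewrite mulr_ge0 //; lra.
  have -> : s * (1 + eta * slope_rate) = s + eta * (slope_rate * s) by ring.
  set bs := slope_rate * s in bs0 *.
  have tbs : t * (bs * eta) <= bs * eta.
    have t_le1 : t <= 1 by lra.
    by rewrite ler_piMl // mulr_ge0 // ltW.
  have [ts|/ltW ts] := leP t s.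
    have te : t * eta <= t by nra.
    rewrite ramp_neg ?subr_le0 // subr0; lra.
  have se' : s * eta <= s by nra.
  rewrite ramp_pos ?subr_ge0 //; lra.
rewrite green_eta_right // /green slope_right //.
set a := (1 - s) / _; have a0 : 0 <= a by apply: quotient_ge0; lra.
have r0 : 0 <= ramp (t - s) by rewrite le_max lexx orbT.
rewrite [leRHS]mulrC ler_pM2r //; nra.
Qed.

(** The second term vanishes for [t <= s] and is [(t - s) * s] otherwise;
    this is what relates bounds on the primitive to bounds on the Green
    function. *)
Lemma green_intE t s :
  green_int t s = (t * green t s + ramp (t - s) * (t - ramp (t - s))) / 2.
Proof. by rewrite /green_int /green; field. Qed.

Lemma green_int_ge (t s : R) : 0 <= t <= 1 -> 0 <= s <= 1 ->
  t ^+ 2 / 2 * green eta s <= green_int t s.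
Proof.
have [eta_gt0 eta_lt1 alpha_gt1 kappa_gt0] := dataP.
move=> t1 s1; rewrite green_intE.
have H : 0 <= ramp (t - s) * (t - ramp (t - s)).
  have [ts|/ltW ts] := leP t s; first by rewrite ramp_neg ?subr_le0 // mul0r.
  by rewrite ramp_pos ?subr_ge0 // mulr_ge0 //; lra.
have : t * (t * green eta s) <= t * green t s.
  by apply: ler_wpM2l (green_ge t1 s1); lra.
rewrite expr2; lra.
Qed.

Lemma green_eta_ge0 (s : R) : 0 <= s <= 1 -> 0 <= green eta s.
Proof.
have [eta_gt0 eta_lt1 alpha_gt1 kappa_gt0] := dataP.
move=> s1; have [se|/ltW se] := leP s eta.
  rewrite green_eta_left // mulr_ge0 //; first lra.
  have := mulr_ge0 (ltW eta_gt0) slope_rate_ge0; lra.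
rewrite green_eta_right //; apply: (mulr_ge0 (ltW eta_gt0)).
by apply: quotient_ge0; case/andP: s1.
Qed.

Lemma green_int_le (t s : R) : 0 <= t <= 1 -> 0 <= s <= 1 ->
  green_int t s <= green eta s / eta.
Proof.
have [eta_gt0 eta_lt1 alpha_gt1 kappa_gt0] := dataP.
move=> t1 s1; rewrite green_intE.
have G0 : 0 <= green eta s / eta by rewrite divr_ge0 ?green_eta_ge0 // ltW.
have : t * green t s <= green eta s / eta.
  apply: le_trans (_ : t * (green eta s / eta) <= _).
    by apply: ler_wpM2l (green_le t1 s1); lra.
  by rewrite ler_piMl //; lra.
suff : ramp (t - s) * (t - ramp (t - s)) <= green eta s / eta by lra.
have [ts|/ltW ts] := leP t s; first by rewrite ramp_neg ?subr_le0 // mul0r.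
rewrite ramp_pos ?subr_ge0 // ler_pdivlMr //.
rewrite (_ : t - (t - s) = s); last by ring.
have [se|/ltW se] := leP s eta.
  rewrite green_eta_left //.
  have := mulr_ge0 (proj1 (andP s1)) (mulr_ge0 (ltW eta_gt0) slope_rate_ge0).
  have tse : (t - s) * eta <= 1 by nra.
  have : s * ((t - s) * eta) <= s by rewrite ler_piMr //; lra.
  lra.
rewrite green_eta_right // [leRHS]mulrC ler_pM2r //.
apply: le_trans (_ : 1 - s <= _); first nra.
have s_le1 : 0 <= 1 - s by lra.
have k1 : 1 - alpha * eta <= 1 by have := kappa_lt; lra.
by rewrite ler_pdivlMr // ler_piMr.
Qed.

Lemma green_three_point (s : R) : 0 <= s <= 1 -> green 1 s = alpha * green eta s.
Proof.
have [eta_gt0 eta_lt1 alpha_gt1 kappa_gt0] := dataP.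
move=> s1; rewrite /green (ramp_pos (x := 1 - s)) ?subr_ge0; last lra.
by rewrite /slope; field; rewrite gt_eqF.
Qed.

End Green.

(** * Means over a regular grid *)

Section Mean.
Variable R : realType.

(** Midpoints rather than left end points, because the Green function
    vanishes for a pole at 0 or 1. *)
Definition node (n : nat) (j : 'I_n.+1) : R := (j%:R + 1 / 2) / n.+1%:R.

Definition mean (n : nat) (g : 'I_n.+1 -> R) : R := (\sum_j g j) / n.+1%:R.

Lemma natS_gt0 n : 0 < n.+1%:R :> R.
Proof. by rewrite ltr0n. Qed.

Lemma node_bounds n (j : 'I_n.+1) : 0 < node j < 1.
Proof.
have n0 := natS_gt0 n; have jn : j%:R + 1 <= n.+1%:R :> R.
  by rewrite -natr1 lerD2r ler_nat -ltnS.
have j0 : 0 <= j%:R :> R by [].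
have h1 : 0 < j%:R + 1 / 2 :> R by lra.
have h2 : j%:R + 1 / 2 < n.+1%:R :> R by lra.
by apply/andP; split; [exact: divr_gt0 | rewrite /node ltr_pdivrMr // [ltRHS]mul1r].
Qed.

Lemma node_itv n (j : 'I_n.+1) : 0 <= node j <= 1.
Proof. by have /andP[/ltW -> /ltW ->] := node_bounds j. Qed.

Lemma mean_le n (g h : 'I_n.+1 -> R) :
  (forall j, g j <= h j) -> mean g <= mean h.
Proof.
by move=> gh; rewrite /mean ler_pM2r ?invr_gt0 ?natS_gt0 // ler_sum.
Qed.

Lemma mean_ge0 n (g : 'I_n.+1 -> R) : (forall j, 0 <= g j) -> 0 <= mean g.
Proof. by move=> g0; rewrite /mean divr_ge0 // sumr_ge0. Qed.

Lemma mean_cst n (k : R) : mean (fun _ : 'I_n.+1 => k) = k.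
Proof.
by rewrite /mean sumr_const card_ord -[k *+ _]mulr_natr mulfK // gt_eqF ?natS_gt0.
Qed.

Lemma meanD n (g h : 'I_n.+1 -> R) :
  mean (fun j => g j + h j) = mean g + mean h.
Proof. by rewrite /mean big_split mulrDl. Qed.

Lemma meanN n (g : 'I_n.+1 -> R) : mean (fun j => - g j) = - mean g.
Proof. by rewrite /mean sumrN mulNr. Qed.

Lemma meanB n (g h : 'I_n.+1 -> R) :
  mean (fun j => g j - h j) = mean g - mean h.
Proof. by rewrite meanD meanN. Qed.

Lemma meanZ n k (g : 'I_n.+1 -> R) : mean (fun j => k * g j) = k * mean g.
Proof. by rewrite /mean -mulr_sumr mulrA. Qed.

Lemma eq_mean n (g h : 'I_n.+1 -> R) : g =1 h -> mean g = mean h.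
Proof. by move=> gh; rewrite /mean (eq_bigr h). Qed.

Lemma norm_mean n (g : 'I_n.+1 -> R) : `|mean g| <= mean (fun j => `|g j|).
Proof.
rewrite ler_norml -meanN; apply/andP; split; apply: mean_le => j.
  by rewrite lerNl -normrN ler_norm.
exact: ler_norm.
Qed.

Lemma count_nat_lt n (y : R) : -1 <= y -> y <= n%:R ->
  y <= \sum_(j < n) (j%:R < y)%R%:R /\ \sum_(j < n) (j%:R < y)%R%:R <= y + 1.
Proof.
elim: n => [|n IHn] y1 yn; first by rewrite big_ord0; split; lra.
rewrite big_ord_recr /=; have [ny|ny] := ltP n%:R y; last first.
  by rewrite addr0; apply: IHn.
rewrite (eq_bigr (fun=> 1)) => [|j _]; last first.
  by rewrite (lt_trans _ ny) // ltr_nat.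
rewrite -natr1 in yn; rewrite sumr_const card_ord /=; split; lra.
Qed.

Lemma mean_lt n (t : R) : 0 <= t <= 1 ->
  `|mean (fun j : 'I_n.+1 => (node j < t)%R%:R) - t| <= 1 / 2 / n.+1%:R.
Proof.
move=> t1; have n0 := natS_gt0 n; set N := n.+1%:R in n0 *.
have Nt : 0 <= N * t <= N by nra.
have [||c1 c2] := @count_nat_lt n.+1 (N * t - 1 / 2); [lra| |].
  rewrite -/N; lra.
rewrite (eq_mean (h := fun j => (j%:R < N * t - 1 / 2)%R%:R)); last first.
  by move=> j; rewrite /node ltr_pdivrMr // [t * _]mulrC ltrBrDr.
rewrite /mean -/N; set c := \sum_(j < _) _ in c1 c2 *.
rewrite (_ : c / N - t = (c - N * t) / N); last by field; rewrite gt_eqF.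
rewrite normrM (gtr0_norm (x := N^-1)) ?invr_gt0 // ler_pM2r ?invr_gt0 //.
rewrite ler_norml; lra.
Qed.

(** The grid points are equidistributed with an error independent of the
    interval; this replaces any convergence theorem for Riemann sums. *)
Lemma mean_itv n (a b : R) : 0 <= a -> a <= b -> b <= 1 ->
  `|mean (fun j : 'I_n.+1 => (a <= node j < b)%R%:R) - (b - a)| <= 1 / n.+1%:R.
Proof.
move=> a0 ab b1; have := @mean_lt n a; have := @mean_lt n b.
set mb := mean _; set ma := mean _ => Hb Ha.
rewrite (_ : mean _ = mb - ma); last first.
  rewrite /ma /mb -meanB; apply: eq_mean => j.
  case: (ltP (node j) a) => ja /=; last by rewrite subr0.
  by rewrite (lt_le_trans ja ab) subrr.
have {}Hb := Hb (_ : 0 <= b <= 1); have {}Ha := Ha (_ : 0 <= a <= 1).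
rewrite (_ : mb - ma - (b - a) = (mb - b) - (ma - a)); last by ring.
apply: le_trans (ler_normB _ _) _; apply: le_trans (lerD (Hb _) (Ha _)) _; try lra.
by rewrite -mulrDl; apply: ler_wpM2r => //; lra.
Qed.

End Mean.

(** * The discretised system *)

Lemma continuous_on_domain_cvg (R : realType) (f : R -> R -> R -> R)
    (A : Type) (G : set_system A) (FG : Filter G) (t x y : A -> R) (t0 x0 y0 : R) :
  continuous_on_domain f ->
  (forall a, [/\ 0 <= t a <= 1, 0 <= x a & 0 <= y a]) ->
  0 <= t0 <= 1 -> 0 <= x0 -> 0 <= y0 ->
  t a @[a --> G] --> t0 -> x a @[a --> G] --> x0 -> y a @[a --> G] --> y0 ->
  f (t a) (x a) (y a) @[a --> G] --> f t0 x0 y0.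
Proof.
move=> /subspace_continuousP fc dom t01 x00 y00 ct cx cy.
have := fc (t0, (x0, y0)) (conj t01 (conj x00 y00)).
apply: cvg_trans.
apply: (@cvg_comp _ _ _ (fun a => (t a, (x a, y a)))
  (fun q : R * (R * R) => f q.1 q.2.1 q.2.2)); last exact: cvg_id.
move=> V /= VP.
have cxy : (x a, y a) @[a --> G] --> (x0, y0).
  exact: (@cvg_pair _ _ _ G (nbhs x0) (nbhs y0)).
have ctxy : (t a, (x a, y a)) @[a --> G] --> (t0, (x0, y0)).
  exact: (@cvg_pair _ _ _ G (nbhs t0) (nbhs (x0, y0))).
have : \forall a \near G, unit_itv (t a) /\ quadrant (x a, y a) ->
    V (t a, (x a, y a)) := ctxy _ VP.
apply: (@filterS _ G) => a /=; apply; have [ta xa ya] := dom a.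
by split.
Qed.

Section Discretisation.
Variables (R : realType) (eta alpha : R).
Hypothesis dataP : three_point_data eta alpha.

(** The derivative [u'] of the discrete solution [u] with forcing [g]; the
    solution itself is [pot]. *)
Definition slope_pot n (g : 'I_n.+1 -> R) (t : R) :=
  mean (fun j => green eta alpha t (node R j) * g j).

Definition pot n (g : 'I_n.+1 -> R) (t : R) :=
  mean (fun j => green_int eta alpha t (node R j) * g j).

(** The linear measure of size on nonnegative forcings: the value of [u']
    at [eta]. *)
Definition load n (g : 'I_n.+1 -> R) := slope_pot g eta.

Section Bounds.
Variables (n : nat) (g : 'I_n.+1 -> R).
Hypothesis g_ge0 : forall j, 0 <= g j.

Lemma load_ge0 : 0 <= load g.
Proof.
by apply: mean_ge0 => j; rewrite mulr_ge0 // green_eta_ge0 // node_itv.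
Qed.

Lemma slope_pot_ge t : 0 <= t <= 1 -> t * load g <= slope_pot g t.
Proof.
move=> t1; rewrite /load /slope_pot -meanZ; apply: mean_le => j.
by rewrite mulrA ler_wpM2r // green_ge // node_itv.
Qed.

Lemma slope_pot_le t : 0 <= t <= 1 -> slope_pot g t <= load g / eta.
Proof.
move=> t1; rewrite /load /slope_pot mulrC -meanZ; apply: mean_le => j.
by rewrite mulrA ler_wpM2r // mulrC green_le // node_itv.
Qed.

Lemma pot_ge t : 0 <= t <= 1 -> t ^+ 2 / 2 * load g <= pot g t.
Proof.
move=> t1; rewrite /load /slope_pot /pot -meanZ; apply: mean_le => j.
by rewrite mulrA ler_wpM2r // green_int_ge // node_itv.
Qed.

Lemma pot_le t : 0 <= t <= 1 -> pot g t <= load g / eta.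
Proof.
move=> t1; rewrite /load /slope_pot /pot mulrC -meanZ; apply: mean_le => j.
by rewrite mulrA ler_wpM2r // mulrC green_int_le // node_itv.
Qed.

Lemma slope_pot_ge0 t : 0 <= t <= 1 -> 0 <= slope_pot g t.
Proof.
move=> t1; apply: le_trans (slope_pot_ge t1); rewrite mulr_ge0 ?load_ge0 //.
by case/andP: t1.
Qed.

Lemma pot_ge0 t : 0 <= t <= 1 -> 0 <= pot g t.
Proof.
by move=> t1; apply: le_trans (pot_ge t1); rewrite mulr_ge0 ?load_ge0 ?divr_ge0 ?sqr_ge0.
Qed.

End Bounds.

(** The size of the forcing [t], the least forcing produced by a solution
    of size 1 and a right-hand side [y]. *)
Definition moment n := mean (fun j : 'I_n.+1 => green eta alpha eta (node R j) * node R j).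

Definition moment_bound : R := eta ^+ 2 * (1 - eta) ^+ 2 / 8.

Lemma moment_bound_gt0 : 0 < moment_bound.
Proof.
have [eta0 eta1 _ _] := dataP; have e1 : 0 < 1 - eta by lra.
by rewrite /moment_bound divr_gt0 // mulr_gt0 // exprn_gt0.
Qed.

(** Only the nodes between [eta] and the midpoint of [eta] and 1 are kept. *)
Lemma moment_ge n : 4 / (1 - eta) <= n.+1%:R -> moment_bound <= moment n.
Proof.
have [eta0 eta1 alpha1 kappa0] := dataP; have e1 : 0 < 1 - eta by lra.
have kE := kappa_lt dataP.
rewrite ler_pdivrMr // => n4; have n0 := natS_gt0 R n.
have ni : 1 / n.+1%:R <= (1 - eta) / 4 by rewrite ler_pdivrMr //; lra.
have em : eta <= (1 + eta) / 2 by lra.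
have m1 : (1 + eta) / 2 <= 1 by lra.
have := @mean_itv R n eta ((1 + eta) / 2) (ltW eta0) em m1.
set m := mean _; set iN := 1 / _ in ni *; move=> mP.
apply: le_trans (_ : eta ^+ 2 * (1 - eta) / 2 * m <= _).
  have mP' : - iN <= m - ((1 + eta) / 2 - eta).
    by move: mP; rewrite ler_norml => /andP[].
  have : (1 - eta) / 4 <= m by lra.
  have : 0 <= eta ^+ 2 * (1 - eta) / 2 by rewrite divr_ge0 // mulr_ge0 ?sqr_ge0 // ltW.
  rewrite /moment_bound; set k := eta ^+ 2 * (1 - eta) / 2 => k0 mk.
  by rewrite (_ : _ / 8 = k * ((1 - eta) / 4)) ?ler_wpM2l // /k; field.
rewrite /m -meanZ; apply: mean_le => j; have sj := node_itv R j.
have G0 := green_eta_ge0 dataP sj; have s0 := proj1 (andP sj).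
case: (leP eta) => s1; last by rewrite mulr0 mulr_ge0.
case: ltP => s2 /=; last by rewrite mulr0 mulr_ge0.
rewrite mulr1 (green_eta_right _ s1) //.
set s := node R j in s0 s1 s2 *.
have : 1 - s <= (1 - s) / (1 - alpha * eta).
  have s3 : 0 <= 1 - s by lra.
  have k1 : 1 - alpha * eta <= 1 by lra.
  by rewrite ler_pdivlMr // ler_piMr.
set a := _ / _ => aP.
have h1 : (1 - eta) / 2 <= a by lra.
have h2 : eta * eta <= eta * s by rewrite ler_pM2l.
have h3 : 0 <= eta * eta by rewrite mulr_ge0 ?ltW.
rewrite (_ : _ / 2 = (eta * eta) * ((1 - eta) / 2)); last by field.
rewrite (_ : eta * a * s = (eta * s) * a); last by ring.
by apply: ler_pM => //; lra.
Qed.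

Variable F : bool -> R -> R -> R -> R.
Hypothesis F_ge0 : forall b, nonneg_on_domain (F b).

Definition component n (g : bool * 'I_n.+1 -> R) b := fun j => g (b, j).

Definition total_load n (g : bool * 'I_n.+1 -> R) :=
  load (component g true) + load (component g false).

(** The index [b] selects the equation; its right-hand side involves the
    solution of the other one, [~~ b].  The constant [e] keeps the forcing
    from vanishing. *)
Definition forcing n (e : R) (g : bool * 'I_n.+1 -> R) (i : bool * 'I_n.+1) :=
  F i.1 (node R i.2) (pot (component g (~~ i.1)) (node R i.2))
    (slope_pot (component g (~~ i.1)) (node R i.2)) + e.

Lemma total_loadE n (g : bool * 'I_n.+1 -> R) b :
  total_load g = load (component g b) + load (component g (~~ b)).
Proof. by case: b; rewrite // addrC. Qed.

Lemma load_le_total n (g : bool * 'I_n.+1 -> R) b (x : R) : orthant g ->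
  0 <= x <= load (component g b) / eta -> 0 <= x <= total_load g / eta.
Proof.
have [eta0 eta1 alpha1 kappa0] := dataP => g0 /andP[-> /le_trans]; apply.
rewrite ler_pM2r ?invr_gt0 // (total_loadE g b) lerDl.
by apply: load_ge0 => j; apply: g0.
Qed.

Lemma forcing_ge n e (g : bool * 'I_n.+1 -> R) i : orthant g -> e <= forcing e g i.
Proof.
move=> g0; rewrite /forcing lerDr; apply: F_ge0; first exact: node_itv.
have c0 b j : 0 <= component g b j by apply: g0.
by split; [apply: pot_ge0|apply: slope_pot_ge0]; rewrite ?node_itv.
Qed.

Lemma load_forcing_le n e (g : bool * 'I_n.+1 -> R) b (d D : R) :
  orthant g -> 0 <= e -> 0 <= d -> 0 <= D ->
  (forall t x y, 0 <= t <= 1 -> 0 <= x <= load (component g (~~ b)) / eta ->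
     0 <= y <= load (component g (~~ b)) / eta -> F b t x y <= d * (x + y) + D) ->
  load (component (forcing e g) b)
    <= (1 - alpha * eta)^-1 *
       (d * (2 / eta * load (component g (~~ b))) + D + e).
Proof.
have [eta0 eta1 alpha1 kappa0] := dataP.
move=> g0 e0 d0 D0 FP; set K := _ + e.
have c0 b' j : 0 <= component g b' j by apply: g0.
have L0 b' : 0 <= load (component g b') by apply: load_ge0.
rewrite -[leRHS](mean_cst n) /load /slope_pot; apply: mean_le => j.
have sj := node_itv R j.
have V0 := pot_ge0 (c0 (~~ b)) sj; have W0 := slope_pot_ge0 (c0 (~~ b)) sj.
have V1 := pot_le (c0 (~~ b)) sj; have W1 := slope_pot_le (c0 (~~ b)) sj.
apply: ler_pM (green_eta_le dataP sj) _.
- exact: green_eta_ge0.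
- exact: le_trans e0 (forcing_ge _ _ g0).
rewrite /component /forcing /K lerD2r; apply: le_trans (FP _ _ _ sj _ _) _.
- by rewrite V0.
- by rewrite W0.
rewrite lerD2r ler_wpM2l //; apply: le_trans (lerD V1 W1) _.
by rewrite -mulr2n -[_ *+ 2]mulr_natl mulrA mulrAC.
Qed.

Lemma load_forcing_ge n e (g : bool * 'I_n.+1 -> R) b (N D : R) :
  orthant g -> 0 <= e -> 0 <= N -> 0 <= D ->
  (forall t x y, 0 <= t <= 1 -> 0 <= x <= load (component g (~~ b)) / eta ->
     0 <= y <= load (component g (~~ b)) / eta -> N * (x + y) - D <= F b t x y) ->
  N * load (component g (~~ b)) * moment n - (1 - alpha * eta)^-1 * D
    <= load (component (forcing e g) b).
Proof.
have [eta0 eta1 alpha1 kappa0] := dataP.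
move=> g0 e0 N0 D0 FP.
have c0 b' j : 0 <= component g b' j by apply: g0.
have L0 b' : 0 <= load (component g b') by apply: load_ge0.
rewrite /moment -meanZ -[X in _ - X](mean_cst n) -meanB {2}/load /slope_pot.
apply: mean_le => j; have sj := node_itv R j.
have V0 := pot_ge0 (c0 (~~ b)) sj; have W0 := slope_pot_ge0 (c0 (~~ b)) sj.
have V1 := pot_le (c0 (~~ b)) sj; have W1 := slope_pot_le (c0 (~~ b)) sj.
have W2 := slope_pot_ge (c0 (~~ b)) sj.
have G0 := green_eta_ge0 dataP sj; have G1 := green_eta_le dataP sj.
rewrite /component /forcing /=; set G := green _ _ _ _ in G0 G1 *.
have := FP _ _ _ sj _ _; move=> /(_ (pot (component g (~~ b)) (node R j))).
move=> /(_ (slope_pot (component g (~~ b)) (node R j))).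
rewrite V0 W0 V1 W1 => /(_ isT isT).
set f := F _ _ _ _ => Hf.
apply: le_trans (_ : G * (N * (node R j * load (component g (~~ b)))) - G * D <= _).
  rewrite lerB ?ler_wpM2r //.
  by rewrite le_eqVlt; apply/orP; left; apply/eqP; ring.
rewrite -mulrBr ler_wpM2l //.
have := ler_wpM2l N0 W2; have := mulr_ge0 N0 V0; lra.
Qed.
End Discretisation.

(** * Solutions of the discretised system *)

Section GrowthForms.
Variables (R : realType) (f : R -> R -> R -> R).

(** Sublinearity and superlinearity at the origin and at infinity, in the
    form used by the size estimates; unlike the ratios in the limits, they
    make sense at the origin as well. *)
Definition small_upper := forall d, 0 < d -> exists2 rho, 0 < rho &
  forall t x y, 0 <= t <= 1 -> 0 <= x <= rho -> 0 <= y <= rho ->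
    f t x y <= d * (x + y).

Definition small_lower := forall N, 0 < N -> exists2 rho, 0 < rho &
  forall t x y, 0 <= t <= 1 -> 0 <= x <= rho -> 0 <= y <= rho ->
    N * (x + y) <= f t x y.

Definition large_upper := forall d, 0 < d -> exists2 D, 0 <= D &
  forall t x y, 0 <= t <= 1 -> 0 <= x -> 0 <= y -> f t x y <= d * (x + y) + D.

Definition large_lower := forall N, 0 < N -> exists2 D, 0 <= D &
  forall t x y, 0 <= t <= 1 -> 0 <= x -> 0 <= y -> N * (x + y) - D <= f t x y.

End GrowthForms.

Section DiscreteFixpoints.
Variables (R : realType) (eta alpha : R).
Hypothesis dataP : three_point_data eta alpha.
Variable F : bool -> R -> R -> R -> R.
Hypothesis F_cont : forall b, continuous_on_domain (F b).
Hypothesis F_ge0 : forall b, nonneg_on_domain (F b).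

Local Notation forcing := (forcing eta alpha F).
Local Notation load := (load eta alpha).
Local Notation total_load := (total_load eta alpha).

Lemma discrete_fixpoint n (e p q : R) : 0 < e -> 0 < p -> 0 < q ->
  (forall g : bool * 'I_n.+1 -> R, orthant g -> total_load g = p ->
     p < total_load (forcing e g)) ->
  (forall g : bool * 'I_n.+1 -> R, orthant g -> total_load g = q ->
     total_load (forcing e g) < q) ->
  exists g : bool * 'I_n.+1 -> R,
    [/\ orthant g, forcing e g = g
      & Num.min p q <= total_load g <= Num.max p q].
Proof.
move=> e0 p0 q0 Hp Hq.
pose c (i : bool * 'I_n.+1) : R := green eta alpha eta (node R i.2) / n.+1%:R.
have c0 i : 0 < c i.
  by apply: divr_gt0 (natS_gt0 R n); apply: green_eta_gt0 (node_bounds R _).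
have weightE g : weight c g = total_load g.
  rewrite /weight (eq_bigr (fun i => c (i.1, i.2) * g (i.1, i.2))) => [|[]//].
  rewrite -(pair_bigA _ (fun b j => c (b, j) * g (b, j))) /= big_bool.
  rewrite /total_load /load /slope_pot /mean !mulr_suml.
  by congr (_ + _); apply: eq_bigr => j _; rewrite /c mulrAC.
have I0 : (0 < #|{: bool * 'I_n.+1}|)%N by apply/card_gt0P; exists (true, ord0).
have S0 g : orthant g -> orthant (forcing e g).
  by move=> g0 i; apply: le_trans (forcing_ge _ _ _ _ _); rewrite ?ltW.
have [|||||g [g0 gE gb]] := @krasnoselskii_orthant R _ c (forcing e) p q I0 c0 p0 q0.
- exact: S0.
- move=> G GP g l g0 l0 gl [b j].
  have pot_c b' (K : R -> R -> R) t :
      mean (fun k => K t (node R k) * component (g m) b' k) @[m --> G]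
        --> mean (fun k => K t (node R k) * component l b' k).
    apply: cvgMr_tmp; apply: cvg_finsum => k; apply: cvgMl_tmp; exact: gl.
  apply: cvgD; last exact: cvg_cst.
  apply: continuous_on_domain_cvg => //=.
  + move=> m; have gm0 b' k : 0 <= component (g m) b' k by apply: g0.
    by split; [exact: node_itv|apply: pot_ge0|apply: slope_pot_ge0] => //; exact: node_itv.
  + exact: node_itv.
  + by apply: pot_ge0 => //; [move=> k; apply: l0|exact: node_itv].
  + by apply: slope_pot_ge0 => //; [move=> k; apply: l0|exact: node_itv].
  + exact: cvg_cst.
  + exact: pot_c.
  + exact: pot_c.
- move=> g g0; have S1 i : 0 < forcing e g i.
    by apply: lt_le_trans (forcing_ge _ _ _ _ _).
  rewrite /weight (bigD1 (true, ord0)) //=.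
  apply: ltr_pwDl; first exact: mulr_gt0.
  by apply: sumr_ge0 => i _; apply: mulr_ge0; apply: ltW.
- by move=> g g0; rewrite !weightE; apply: Hp.
- by move=> g g0; rewrite !weightE; apply: Hq.
by exists g; rewrite -weightE.
Qed.

Lemma total_load_le n (e d D : R) (g : bool * 'I_n.+1 -> R) :
  orthant g -> 0 <= e -> 0 <= d -> 0 <= D ->
  (forall b t x y, 0 <= t <= 1 -> 0 <= x <= total_load g / eta ->
     0 <= y <= total_load g / eta -> F b t x y <= d * (x + y) + D) ->
  total_load (forcing e g) <=
    (1 - alpha * eta)^-1 * (d * (2 / eta * total_load g) + 2 * D + 2 * e).
Proof.
move=> g0 e0 d0 D0 FP.
have FP' b t x y : 0 <= t <= 1 -> 0 <= x <= load (component g (~~ b)) / eta ->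
    0 <= y <= load (component g (~~ b)) / eta -> F b t x y <= d * (x + y) + D.
  by move=> t1 /(load_le_total dataP g0) x1 /(load_le_total dataP g0) /(FP b t x y t1 x1).
have Lt := load_forcing_le dataP F_ge0 g0 e0 d0 D0 (FP' true).
have Lf := load_forcing_le dataP F_ge0 g0 e0 d0 D0 (FP' false).
apply: le_trans (lerD Lt Lf) _; rewrite -mulrDr /= /total_load.
by rewrite le_eqVlt; apply/orP; left; apply/eqP; ring.
Qed.

Lemma total_load_ge n (e N D : R) (g : bool * 'I_n.+1 -> R) :
  orthant g -> 0 <= e -> 0 <= N -> 0 <= D -> 4 / (1 - eta) <= n.+1%:R ->
  (forall b t x y, 0 <= t <= 1 -> 0 <= x <= total_load g / eta ->
     0 <= y <= total_load g / eta -> N * (x + y) - D <= F b t x y) ->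
  N * moment_bound eta * total_load g - (1 - alpha * eta)^-1 * (2 * D)
    <= total_load (forcing e g).
Proof.
move=> g0 e0 N0 D0 n4 FP.
have FP' b t x y : 0 <= t <= 1 -> 0 <= x <= load (component g (~~ b)) / eta ->
    0 <= y <= load (component g (~~ b)) / eta -> N * (x + y) - D <= F b t x y.
  by move=> t1 /(load_le_total dataP g0) x1 /(load_le_total dataP g0) /(FP b t x y t1 x1).
have Lt := load_forcing_ge dataP g0 e0 N0 D0 (FP' true).
have Lf := load_forcing_ge dataP g0 e0 N0 D0 (FP' false).
apply: le_trans (lerD Lt Lf).
have c0 b j : 0 <= component g b j by apply: g0.
have L0 b : 0 <= load (component g b) by apply: load_ge0.
have M := moment_ge dataP n4.
have Mt := ler_wpM2l (mulr_ge0 N0 (L0 true)) M.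
have Mf := ler_wpM2l (mulr_ge0 N0 (L0 false)) M.
rewrite /total_load /=; lra.
Qed.

Lemma near_large_index (K : R) : \forall n \near \oo, K <= n.+1%:R.
Proof.
near=> n; apply: le_trans (_ : n%:R <= _); last by rewrite ler_nat.
near: n; exact: nbhs_infty_ger.
Unshelve. all: by end_near. Qed.

(** The constant [eta * k / 8] makes the linear part of the forcing
    multiply sizes by at most [1/4], and [2 / m] makes it multiply them by
    at least 2; the additive constants are then absorbed by choosing [p]
    or [q] large, or the grid fine. *)
Lemma discrete_fixpoints :
  (forall b, small_upper (F b)) /\ (forall b, large_lower (F b)) \/
  (forall b, small_lower (F b)) /\ (forall b, large_upper (F b)) ->
  exists r K : R, 0 < r /\ \forall n \near \oo,
    exists g : bool * 'I_n.+1 -> R,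
      [/\ orthant g, forcing (n.+1%:R)^-1 g = g & r <= total_load g <= K].
Proof.
have [eta0 eta1 alpha1 kappa0] := dataP.
set k := 1 - alpha * eta in kappa0 *.
have m0 := moment_bound_gt0 dataP; set m := moment_bound eta in m0 *.
have d0 : 0 < eta * k / 8 by rewrite divr_gt0 // mulr_gt0.
have N0 : 0 < 2 / m by rewrite divr_gt0.
have Nm : 2 / m * m = 2 by rewrite divfK // gt_eqF.
have dE x y z : k^-1 * (eta * k / 8 * (2 / eta * x) + y + z) =
    x / 4 + k^-1 * y + k^-1 * z.
  by field; rewrite !gt_eqF.
have eP (n : nat) : 0 < (n.+1%:R)^-1 :> R by rewrite invr_gt0 natS_gt0.
have k_gt0 : 0 < k^-1 by rewrite invr_gt0.
case=> -[Hs Hl].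
- have [rt rt0 rtP] := Hs true _ d0; have [rf rf0 rfP] := Hs false _ d0.
  pose rho := Num.min rt rf.
  have rho0 : 0 < rho by rewrite lt_min rt0.
  have sP b t x y : 0 <= t <= 1 -> 0 <= x <= rho -> 0 <= y <= rho ->
      F b t x y <= eta * k / 8 * (x + y) + 0.
    rewrite addr0 !le_min => t1 /and3P[x0 x1 x2] /and3P[y0 y1 y2].
    by case: b; [apply: rtP|apply: rfP] => //; apply/andP.
  have [Dt Dt0 DtP] := Hl true _ N0; have [Df Df0 DfP] := Hl false _ N0.
  pose D := Dt + Df; have D0 : 0 <= D by rewrite addr_ge0.
  have lP b t x y : 0 <= t <= 1 -> 0 <= x -> 0 <= y ->
      2 / m * (x + y) - D <= F b t x y.
    move=> t1 x0 y0; rewrite /D; case: b.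
      by have := DtP t x y t1 x0 y0; lra.
    by have := DfP t x y t1 x0 y0; lra.
  pose p := k^-1 * (2 * D) + 1; pose q := rho * eta.
  have p0 : 0 < p by rewrite ltr_wpDl // (mulr_ge0 (ltW k_gt0)) // mulr_ge0.
  have q0 : 0 < q by rewrite mulr_gt0.
  exists (Num.min p q), (Num.max p q); split; first by rewrite lt_min p0.
  near=> n.
  apply: discrete_fixpoint => // g g0 gE.
    have n4 : 4 / (1 - eta) <= n.+1%:R by near: n; exact: near_large_index.
    apply: lt_le_trans (total_load_ge g0 (ltW (eP n)) (ltW N0) D0 n4 _).
      rewrite Nm gE -/k /p; lra.
    by move=> b t x y t1 /andP[x0 _] /andP[y0 _]; apply: lP.
  apply: le_lt_trans (total_load_le g0 (ltW (eP n)) (ltW d0) (lexx 0) _) _.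
    by rewrite gE /q mulfK ?gt_eqF.
  rewrite gE -/k dE mulr0 mulr0 addr0.
  have en : k^-1 * (2 * n.+1%:R^-1) <= q / 4.
    have : 8 * k^-1 / q <= n.+1%:R by near: n; exact: near_large_index.
    rewrite ler_pdivrMr // => qn.
    rewrite mulrA ler_pdivrMr ?natS_gt0 //; lra.
  by apply: le_lt_trans (lerD (lexx (q / 4)) en) _; move: (q) q0 => q' q0; lra.
- have [rt rt0 rtP] := Hs true _ N0; have [rf rf0 rfP] := Hs false _ N0.
  pose rho := Num.min rt rf.
  have rho0 : 0 < rho by rewrite lt_min rt0.
  have sP b t x y : 0 <= t <= 1 -> 0 <= x <= rho -> 0 <= y <= rho ->
      2 / m * (x + y) - 0 <= F b t x y.
    rewrite subr0 !le_min => t1 /and3P[x0 x1 x2] /and3P[y0 y1 y2].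
    by case: b; [apply: rtP|apply: rfP] => //; apply/andP.
  have [Dt Dt0 DtP] := Hl true _ d0; have [Df Df0 DfP] := Hl false _ d0.
  pose D := Dt + Df; have D0 : 0 <= D by rewrite addr_ge0.
  have lP b t x y : 0 <= t <= 1 -> 0 <= x -> 0 <= y ->
      F b t x y <= eta * k / 8 * (x + y) + D.
    move=> t1 x0 y0; rewrite /D; case: b.
      by have := DtP t x y t1 x0 y0; lra.
    by have := DfP t x y t1 x0 y0; lra.
  pose p := rho * eta; pose q := 4 * (k^-1 * (D + 1)).
  have p0 : 0 < p by rewrite mulr_gt0.
  have q0 : 0 < q by rewrite mulr_gt0 // mulr_gt0 // ltr_wpDl.
  exists (Num.min p q), (Num.max p q); split; first by rewrite lt_min p0.
  near=> n.
  apply: discrete_fixpoint => // g g0 gE.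
    have n4 : 4 / (1 - eta) <= n.+1%:R by near: n; exact: near_large_index.
    apply: lt_le_trans (total_load_ge g0 (ltW (eP n)) (ltW N0) (lexx 0) n4 _).
      rewrite Nm gE !mulr0 subr0; lra.
    by rewrite gE /p mulfK ?gt_eqF.
  apply: le_lt_trans (total_load_le g0 (ltW (eP n)) (ltW d0) D0 _) _.
    by move=> b t x y t1 /andP[x0 _] /andP[y0 _]; apply: lP.
  rewrite gE -/k dE.
  have n1 : n.+1%:R^-1 <= 1 :> R by rewrite invf_le1 ?natS_gt0 // ler1n.
  have kn := ler_wpM2l (ltW k_gt0) n1; rewrite mulr1 in kn.
  have qE : q = 4 * (k^-1 * D) + 4 * k^-1 by rewrite /q; ring.
  move: (q) (k^-1) (n.+1%:R^-1) q0 qE kn => q' k' n' q'0 qE kn; lra.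
Unshelve. all: by end_near. Qed.

End DiscreteFixpoints.

(** * Growth conditions without upper and lower limits *)

Section GrowthConditions.
Variables (R : realType) (f : R -> R -> R -> R).

Lemma sublinear_at_ratio (F : set_system (R * R)) (d : R) :
  sublinear_at F f -> 0 < d -> exists2 V, F V & forall p t, V p ->
    0 <= t <= 1 -> f t p.1 p.2 / (`|p.1| + `|p.2|) <= d.
Proof.
rewrite /sublinear_at limf_esupE => f0 d0.
have : (ereal_inf [set ereal_sup (sup_ratio f @` V) | V in F] < d%:E)%E.
  by rewrite f0 lte_fin.
move=> /ereal_inf_lt[_ [V FV <-] Vd]; exists V => // p t Vp t1.
rewrite -lee_fin; apply: le_trans (ltW Vd).
apply: le_trans (_ : sup_ratio f p <= _)%E; first by apply: ereal_sup_ubound; exists t.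
by apply: ereal_sup_ubound; exists p.
Qed.

Lemma superlinear_at_ratio (F : set_system (R * R)) (N : R) :
  superlinear_at F f -> exists2 V, F V & forall p t, V p ->
    0 <= t <= 1 -> N <= f t p.1 p.2 / (`|p.1| + `|p.2|).
Proof.
rewrite /superlinear_at limf_einfE => foo.
have : (N%:E < ereal_sup [set ereal_inf (inf_ratio f @` V) | V in F])%E.
  by rewrite foo ltry.
move=> /ereal_sup_gt[_ [V FV <-] Vd]; exists V => // p t Vp t1.
rewrite -lee_fin; apply: le_trans (ltW Vd) _.
apply: le_trans (_ : _ <= inf_ratio f p)%E _; first by apply: ereal_inf_lbound; exists p.
by apply: ereal_inf_lbound; exists t.
Qed.

Lemma near_origin_square (V : set (R * R)) : near_origin V ->
  exists2 rho, 0 < rho & forall x y, 0 <= x <= rho -> 0 <= y <= rho ->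
    0 < x + y -> V (x, y).
Proof.
rewrite /near_origin /within /= => /nbhs_ballP[e /= e0 eV].
exists (e / 2); first by rewrite divr_gt0.
move=> x y x1 y1 xy; have e2 : e / 2 < e by rewrite ltr_pdivrMr //; lra.
apply: eV; last by split; [case/andP: x1|case/andP: y1].
- by split; rewrite -ball_normE /ball_ /= sub0r normrN ger0_norm; lra.
- by apply/eqP => -[x0 y0]; move: xy; rewrite x0 y0 addr0 ltxx.
Qed.

Lemma ratio_le (a x y d : R) : 0 <= x -> 0 <= y -> 0 < x + y ->
  (a / (`|x| + `|y|) <= d) = (a <= d * (x + y)).
Proof. by move=> x0 y0 xy; rewrite !ger0_norm // ler_pdivrMr. Qed.

Lemma ratio_ge (a x y d : R) : 0 <= x -> 0 <= y -> 0 < x + y ->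
  (d <= a / (`|x| + `|y|)) = (d * (x + y) <= a).
Proof. by move=> x0 y0 xy; rewrite !ger0_norm // ler_pdivlMr. Qed.

Hypothesis f_cont : continuous_on_domain f.
Hypothesis f_ge0 : nonneg_on_domain f.

Lemma domain_bounded (M : R) : exists2 D, 0 <= D &
  forall t x y, 0 <= t <= 1 -> 0 <= x <= M -> 0 <= y <= M -> f t x y <= D.
Proof.
pose A := `[0, 1]%classic `*` (`[0, M]%classic `*` `[0, M]%classic) : set (R * (R * R)).
have Ac : compact A by do 2!(apply: compact_setX; first exact: segment_compact); exact: segment_compact.
have fA : {within A, continuous (fun q => f q.1 q.2.1 q.2.2)}.
  apply: continuous_subspaceW f_cont => -[t [x y]] /=.
  by case=> t1 [/andP[x0 _] /andP[y0 _]].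
have /compact_bounded[D [_ DP]] := continuous_compact fA Ac.
exists (`|D| + 1); first by rewrite addr_ge0.
move=> t x y t1 x1 y1; apply: le_trans (ler_norm _) _.
apply: (DP (`|D| + 1)); first by rewrite ltr_pwDr // ler_norm.
by exists (t, (x, y)) => //; rewrite /A /= !in_itv.
Qed.

Lemma sublinear_small_upper : sublinear_at near_origin f -> small_upper f.
Proof.
move=> fs d d0; have [V /near_origin_square[rho rho0 VP] VR] := sublinear_at_ratio fs d0.
exists rho => // t x y t1 x1 y1.
have fxy u v : 0 <= u <= rho -> 0 <= v <= rho -> 0 < u + v -> f t u v <= d * (u + v).
  move=> u1 v1 uv; have u0 : 0 <= u by case/andP: u1.
  have v0 : 0 <= v by case/andP: v1.
  rewrite -ratio_le //.
  exact: VR (VP u v u1 v1 uv) t1.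
have [xy|xy] := ltP 0 (x + y); first exact: fxy.
have [-> ->] : x = 0 /\ y = 0 by lra.
(* the ratio says nothing at the origin, which is reached by continuity *)
have h0 : rho / n.+1%:R @[n --> \oo] --> (0 : R).
  by rewrite -[X in _ --> X](mulr0 rho); apply: cvgMl_tmp; exact: cvg_harmonic.
have hP n : 0 < rho / n.+1%:R by rewrite divr_gt0.
have h_le n : rho / n.+1%:R <= rho by rewrite ler_pdivrMr // ler_peMr ?ler1n // ltW.
rewrite addr0.
apply: (@ler_cvg_to _ \oo _ _ (fun n => f t (rho / n.+1%:R) 0) (fun n => d * (rho / n.+1%:R))).
- apply: continuous_on_domain_cvg => //; try exact: cvg_cst.
  by move=> n; split=> //; exact: ltW.
- exact: cvgMl_tmp.
- near=> n; rewrite -[X in d * X]addr0; apply: fxy; first by rewrite (ltW (hP n)) h_le.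
    by rewrite lexx ltW.
  by rewrite addr0 hP.
Unshelve. all: by end_near. Qed.

Lemma superlinear_small_lower : superlinear_at near_origin f -> small_lower f.
Proof.
move=> fs N N0; have [V /near_origin_square[rho rho0 VP] VR] := superlinear_at_ratio N fs.
exists rho => // t x y t1 x1 y1.
have x0 : 0 <= x by case/andP: x1. have y0 : 0 <= y by case/andP: y1.
have [xy|xy] := ltP 0 (x + y).
  by rewrite -ratio_ge //; exact: VR (VP x y x1 y1 xy) t1.
by apply: le_trans (f_ge0 t1 (conj x0 y0)); rewrite mulr_ge0_le0 // ltW.
Qed.

(** Outside a bounded square a point is in [V]; the bounded part is left
    to compactness or to nonnegativity. *)
Lemma near_infinity_outside (V : set (R * R)) : near_infinity V ->
  exists2 M, 0 <= M & forall x y, 0 <= x -> 0 <= y ->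
    (x <= M /\ y <= M) \/ (0 < x + y /\ V (x, y)).
Proof.
case=> M _ MV; exists `|M| => // x y x0 y0.
have [xM|xM] := leP x `|M|; have [yM|yM] := leP y `|M|; [by left|right..].
all: have MM := ler_norm M; have MM0 := normr_ge0 M; split; first lra.
all: by apply: MV; split=> //=; rewrite lt_max; apply/orP; first [left; lra|right; lra].
Qed.

Lemma sublinear_large_upper : sublinear_at near_infinity f -> large_upper f.
Proof.
move=> fs d d0; have [V /near_infinity_outside[M M0 VP] VR] := sublinear_at_ratio fs d0.
have [D D0 DP] := domain_bounded M; exists D => // t x y t1 x0 y0.
have [[xM yM]|[xy Vxy]] := VP x y x0 y0.
  apply: le_trans (DP t x y t1 _ _) _; rewrite ?x0 ?y0 //.
  by rewrite lerDr (mulr_ge0 (ltW d0)) // addr_ge0.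
apply: le_trans (_ : d * (x + y) <= _); last by rewrite lerDl.
by rewrite -ratio_le //; exact: VR Vxy t1.
Qed.

Lemma superlinear_large_lower : superlinear_at near_infinity f -> large_lower f.
Proof.
move=> fs N N0; have [V /near_infinity_outside[M M0 VP] VR] := superlinear_at_ratio N fs.
exists (N * (2 * M)); first by rewrite !mulr_ge0 // ltW.
move=> t x y t1 x0 y0; have [[xM yM]|[xy Vxy]] := VP x y x0 y0.
  apply: le_trans (f_ge0 t1 (conj x0 y0)).
  by rewrite -mulrBr pmulr_rle0 //; lra.
apply: le_trans (_ : N * (x + y) <= _).
  by rewrite gerBl !mulr_ge0 // ltW.
by rewrite -ratio_ge //; exact: VR Vxy t1.
Qed.

End GrowthConditions.

(** * Derivatives relative to the unit interval *)

Section UnitIntervalCalculus.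
Variable R : realType.
Implicit Types (u w : R -> R) (t : R).

Lemma within_unit_proper t : unit_itv t -> ProperFilter (within unit_itv t^').
Proof.
rewrite /unit_itv /= => t1; apply: Build_ProperFilter_ex => V.
rewrite /within /dnbhs /within /= => /nbhs_ballP[e /= e0 eV].
pose d := Num.min (e / 2) (1 / 2).
have e2 : 0 < e / 2 by rewrite divr_gt0.
have e3 : e / 2 < e by rewrite ltr_pdivrMr //; lra.
have d0 : 0 < d by rewrite lt_min e2; lra.
have de : d < e by rewrite gt_min e3.
have d1 : d <= 1 / 2 by rewrite ge_min lexx orbT.
pose s := if t < 1 / 2 then t + d else t - d.
have [s1 ts] : 0 <= s <= 1 /\ `|t - s| = d.
  rewrite /s; case: ltP => tt.
    rewrite (_ : t - (t + d) = - d) ?normrN ?gtr0_norm //; last by ring.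
    by split => //; lra.
  rewrite (_ : t - (t - d) = d) ?gtr0_norm //; last by ring.
  by split => //; lra.
exists s; apply: eV => //; first by rewrite -ball_normE /= ts.
by apply/eqP => st; move: ts; rewrite st subrr normr0 => d0'; move: d0; rewrite -d0' ltxx.
Qed.

(** A relational form of [derive01]: it only sees the values on the unit
    interval, and so can be iterated although [derive01 u] is known on
    that interval only. *)
Definition has_derivative01 u w :=
  forall t, unit_itv t -> diff_quot u t s @[s --> within unit_itv t^'] --> w t.

(** Only differentiability expansions without division occur below, since
    these survive pointwise limits. *)
Lemma has_derivative01P u w :
  (forall t e, unit_itv t -> 0 < e -> exists2 d, 0 < d & forall s, unit_itv s ->
     `|s - t| < d -> `|u s - u t - (s - t) * w t| <= e * `|s - t|) ->
  has_derivative01 u w.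
Proof.
move=> uw t t1; apply/cvgrPdist_le => e e0; have [d d0 dP] := uw t e t1 e0.
rewrite /within /dnbhs /within /=; apply/nbhs_ballP; exists d => // s.
rewrite -ball_normE /= distrC => sd st s1; have st0 : s - t != 0 by rewrite subr_eq0.
have nst : 0 < `|s - t| by rewrite normr_gt0.
rewrite -(ler_pM2r nst) -normrM mulrBl /diff_quot divfK // [w t * _]mulrC.
by rewrite [leLHS]distrC dP.
Qed.

Lemma has_derivative01_uniq u w1 w2 t : unit_itv t ->
  has_derivative01 u w1 -> has_derivative01 u w2 -> w1 t = w2 t.
Proof.
move=> t1 /(_ t t1) c1 /(_ t t1) c2; have P := within_unit_proper t1.
exact: (cvg_unique (@Rhausdorff R) c1 c2).
Qed.

Lemma eq_has_derivative01 u1 u2 w1 w2 :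
  (forall t, unit_itv t -> u1 t = u2 t) ->
  (forall t, unit_itv t -> w1 t = w2 t) ->
  has_derivative01 u1 w1 -> has_derivative01 u2 w2.
Proof.
move=> u12 w12 uw t t1; rewrite -w12 //; apply: cvg_trans (uw t t1).
have P := within_unit_proper t1; apply: near_eq_cvg.
have : \forall s \near within unit_itv t^', unit_itv s by exact: withinT.
apply: filterS => s s1.
by rewrite /diff_quot !u12.
Qed.

Lemma derive01E u w : has_derivative01 u w ->
  derivable01 u /\ forall t, unit_itv t -> derive01 u t = w t.
Proof.
move=> uw; split=> t t1; first exact: cvgP (uw t t1).
have P := within_unit_proper t1.
by apply: cvg_lim => //; exact: uw.
Qed.

Lemma within_unit_continuousP u :
  (forall t e, unit_itv t -> 0 < e -> exists2 d, 0 < d & forall s, unit_itv s ->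
     `|s - t| < d -> `|u s - u t| <= e) ->
  {within unit_itv, continuous u}.
Proof.
move=> uc; apply/subspace_continuousP => t t1; apply/cvgrPdist_le => e e0.
have [d d0 dP] := uc t e t1 e0.
rewrite /within /=; apply/nbhs_ballP; exists d => // s.
by rewrite -ball_normE /= => ts s1; rewrite distrC dP // distrC.
Qed.

Lemma C01_3_chain u u1 u2 u3 :
  has_derivative01 u u1 -> has_derivative01 u1 u2 -> has_derivative01 u2 u3 ->
  (forall t e, unit_itv t -> 0 < e -> exists2 d, 0 < d & forall s, unit_itv s ->
     `|s - t| < d -> `|u3 s - u3 t| <= e) ->
  [/\ C01 3 u, forall t, unit_itv t -> derive01 u t = u1 t &
      forall t, unit_itv t -> derive01n 3 u t = u3 t].
Proof.
move=> d1 d2 d3 c3; have [v1 e1] := derive01E d1.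
have d2' : has_derivative01 (derive01 u) u2.
  by apply: eq_has_derivative01 d2 => // t /e1 ->.
have [v2 e2] := derive01E d2'.
have d3' : has_derivative01 (derive01 (derive01 u)) u3.
  by apply: eq_has_derivative01 d3 => // t /e2 ->.
have [v3 e3] := derive01E d3'.
split; [split | exact: e1 | exact: e3].
  move=> [|[|[|k]]] k3; [exact: v1|exact: v2|exact: v3|exfalso].
  by move: k3; rewrite !ltnS ltn0.
apply: within_unit_continuousP => t e t1 e0; have [d d0 dP] := c3 t e t1 e0.
by exists d => // s s1 st; rewrite /= !e3 // dP.
Qed.

End UnitIntervalCalculus.

(** * Passage to the limit *)

Lemma continuous_on_domain_eps (R : realType) (f : R -> R -> R -> R) (t x y e : R) :
  continuous_on_domain f -> 0 <= t <= 1 -> 0 <= x -> 0 <= y -> 0 < e ->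
  exists2 d, 0 < d & forall t' x' y', 0 <= t' <= 1 -> 0 <= x' -> 0 <= y' ->
    `|t' - t| < d -> `|x' - x| < d -> `|y' - y| < d -> `|f t' x' y' - f t x y| <= e.
Proof.
move=> /subspace_continuousP fc t1 x0 y0 e0.
have := fc (t, (x, y)) (conj t1 (conj x0 y0)).
move=> /cvgrPdist_le/(_ e e0); rewrite /within /= => /nbhs_ballP[d /= d0 dP].
exists d => // t' x' y' t1' x0' y0' td xd yd; rewrite distrC.
apply: (dP (t', (x', y'))); last by split.
by split; [|split]; rewrite /= -ball_normE /= distrC.
Qed.

Section RampBounds.
Variable R : realType.
Implicit Types x y s t : R.

Lemma ramp_ge0 x : 0 <= ramp x.
Proof. by rewrite le_max lexx orbT. Qed.

Lemma ramp_le x : x <= 1 -> ramp x <= 1.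
Proof. by move=> x1; rewrite ge_max x1 ler01. Qed.

Lemma ramp_lipschitz x y : `|ramp x - ramp y| <= `|x - y|.
Proof.
have := ler_norm (x - y); have := ler_norm (y - x); rewrite (distrC y).
set d := `|x - y| => H1 H2; rewrite ler_norml /ramp /Num.max.
have d0 : 0 <= d by exact: normr_ge0.
by case: ifPn; case: ifPn; rewrite -?leNgt => *; apply/andP; split; lra.
Qed.

(** The half square of the ramp has a 1-Lipschitz derivative. *)
Lemma half_sqr_ramp_taylor x y :
  `|ramp y ^+ 2 / 2 - ramp x ^+ 2 / 2 - (y - x) * ramp x| <= (y - x) ^+ 2.
Proof.
have [x0|/ltW x0] := leP x 0; have [y0|/ltW y0] := leP y 0.
- rewrite (ramp_neg x0) (ramp_neg y0) expr0n /= !mul0r mulr0 !subr0 normr0.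
  exact: sqr_ge0.
- rewrite (ramp_neg x0) (ramp_pos y0) expr0n /= !mul0r mulr0 !subr0.
  rewrite ger0_norm; last by rewrite divr_ge0 // sqr_ge0.
  nra.
- rewrite (ramp_pos x0) (ramp_neg y0) expr0n /= !mul0r sub0r ler_norml.
  apply/andP; split; nra.
- rewrite (ramp_pos x0) (ramp_pos y0).
  rewrite (_ : _ - _ = (y - x) ^+ 2 / 2); last by field.
  by rewrite ger0_norm; have := sqr_ge0 (y - x); lra.
Qed.

(** The kink at [s] is felt only by intervals that contain [s]. *)
Lemma ramp_taylor s x y : 
  `|ramp (y - s) - ramp (x - s) - (y - x) * (s < x)%R%:R|
    <= `|y - x| * (Num.min x y <= s < Num.max x y)%R%:R.
Proof.
have [xy|yx] := leP x y.
  have d0 : 0 <= y - x by lra.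
  rewrite (ger0_norm d0).
  have [sx|sx] := ltP s x => /=.
    rewrite (ramp_pos (x := y - s)); last by lra.
    rewrite (ramp_pos (x := x - s)); last by lra.
    by rewrite (_ : _ - _ = 0) ?normr0 ?mulr0 //; ring.
  rewrite (ramp_neg (x := x - s)); last by lra.
  rewrite mulr0 !subr0 ger0_norm ?ramp_ge0 //.
  have [sy|sy] := ltP s y => /=.
    by rewrite ramp_pos ?mulr1; lra.
  by rewrite ramp_neg ?mulr0; lra.
have d0 : 0 <= x - y by lra.
rewrite [`|y - x|]distrC (ger0_norm d0).
have [sx|sx] := ltP s x => /=.
  rewrite (ramp_pos (x := x - s)); last by lra.
  have [sy|sy] := ltP s y => /=.
    rewrite (ramp_pos (x := y - s)); last by lra.
    by rewrite (_ : _ - _ = 0) ?normr0 ?mulr0 //; ring.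
  rewrite (ramp_neg (x := y - s)); last by lra.
  by rewrite !mulr1 ler_norml; apply/andP; split; lra.
rewrite (ramp_neg (x := x - s)); last by lra.
rewrite (ramp_neg (x := y - s)); last by lra.
by rewrite andbF !mulr0 !subr0 normr0.
Qed.

End RampBounds.

Section Limit.
Variables (R : realType) (eta alpha : R).
Hypothesis dataP : three_point_data eta alpha.
Variable U : set_system nat.
Hypotheses (UU : UltraFilter U) (freeU : \oo `<=` U).
Variables (g : forall n, bool * 'I_n.+1 -> R) (B : R).
Hypotheses (g_ge0 : forall n, orthant (@g n)) (g_le : forall n i, @g n i <= B).

Let UP : ProperFilter U := @ultra_proper _ _ UU.
#[local] Existing Instance UP.

Local Notation comp n b := (component (@g n) b).

Lemma density_bound_ge0 : 0 <= B.
Proof. exact: le_trans (g_ge0 (true, @ord0 0)) (g_le _). Qed.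

Lemma comp_ge0 n b j : 0 <= comp n b j.
Proof. exact: g_ge0. Qed.

Lemma ulim_invS : n.+1%:R^-1 @[n --> U] --> (0 : R).
Proof. by apply: cvg_trans cvg_harmonic; exact: cvg_fmap2. Qed.

Definition bounded01 (K : R -> R) :=
  exists M : R, forall s : R, 0 <= s <= 1 -> `|K s| <= M.

(** The integral of [K] against the limit of the discrete forcings of the
    equation [b], as a positive functional on bounded functions. *)
Definition dens b (K : R -> R) :=
  ulim U (fun n => mean (fun j => K (node R j) * comp n b j)).

Lemma dens_cvg b K : bounded01 K ->
  mean (fun j => K (node R j) * comp n b j) @[n --> U] --> dens b K.
Proof.
move=> [M KM]; apply: (ulim_cvg (b := M * B) UU); apply: nearW => n.
apply: le_trans (norm_mean _) _; rewrite -(mean_cst n (M * B)).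
apply: mean_le => j; rewrite normrM (ger0_norm (comp_ge0 _ _)).
by apply: ler_pM => //; [exact: comp_ge0|exact/KM/node_itv|exact: g_le].
Qed.

#[local] Arguments dens_cvg b {K} _.

Lemma dens_ext b K1 K2 : (forall s, 0 <= s <= 1 -> K1 s = K2 s) ->
  dens b K1 = dens b K2.
Proof.
move=> KK; congr (ulim U _); apply/funext => n; apply: eq_mean => j.
by rewrite KK // node_itv.
Qed.

Lemma bounded01_comb K1 K2 (k : R) : bounded01 K1 -> bounded01 K2 ->
  bounded01 (fun s => K1 s - k * K2 s).
Proof.
move=> [M1 KM1] [M2 KM2]; exists (M1 + `|k| * M2) => s s1.
apply: le_trans (ler_normB _ _) _; rewrite normrM.
by rewrite lerD ?KM1 // ler_wpM2l ?KM2.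
Qed.

Lemma dens_comb b K1 K2 (k : R) : bounded01 K1 -> bounded01 K2 ->
  dens b (fun s => K1 s - k * K2 s) = dens b K1 - k * dens b K2.
Proof.
move=> b1 b2.
apply: (cvg_unique (@Rhausdorff R) (dens_cvg b (bounded01_comb k b1 b2))).
rewrite (_ : (fun n => _) = fun n => mean (fun j => K1 (node R j) * comp n b j)
    - k * mean (fun j => K2 (node R j) * comp n b j)).
  apply: cvgB; first exact: dens_cvg.
  by apply: cvgMl_tmp; exact: dens_cvg.
apply/funext => n; rewrite -meanZ -meanB; apply: eq_mean => j.
by rewrite mulrBl mulrA.
Qed.

Lemma dens_norm b K1 K2 : bounded01 K1 -> bounded01 K2 ->
  (forall s, 0 <= s <= 1 -> `|K1 s| <= K2 s) -> `|dens b K1| <= dens b K2.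
Proof.
move=> b1 b2 KK; apply: (ler_cvg_to (cvg_norm (dens_cvg b b1)) (dens_cvg b b2)).
apply: nearW => n; apply: le_trans (norm_mean _) _; apply: mean_le => j.
by rewrite normrM (ger0_norm (comp_ge0 _ _)) ler_wpM2r ?comp_ge0 // KK // node_itv.
Qed.

Lemma dens_bound b K M : (forall s, 0 <= s <= 1 -> `|K s| <= M) ->
  `|dens b K| <= M * B.
Proof.
move=> KM; have b1 : bounded01 K by exists M.
apply: (cvgr_to_le (cvg_norm (dens_cvg b b1))); apply: nearW => n.
apply: le_trans (norm_mean _) _; rewrite -(mean_cst n (M * B)).
apply: mean_le => j; rewrite normrM (ger0_norm (comp_ge0 _ _)).
by apply: ler_pM => //; [exact: comp_ge0|exact/KM/node_itv|exact: g_le].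
Qed.

Lemma bounded01_bool (P : R -> bool) : bounded01 (fun s => (P s)%:R).
Proof. by exists 1 => s _; case: (P s); rewrite ?normr0 ?normr1. Qed.

Lemma bounded01_slope : bounded01 (slope eta alpha).
Proof.
exists (1 - alpha * eta)^-1 => s s1.
by rewrite ger0_norm ?(slope_ge0 dataP) // slope_le.
Qed.

Lemma bounded01_green t : 0 <= t <= 1 -> bounded01 (green eta alpha t).
Proof.
move=> t1; have [M MP] := bounded01_slope; exists (M + 1) => s s1.
apply: le_trans (ler_normB _ _) _; rewrite normrM.
rewrite [X in _ + X]ger0_norm ?ramp_ge0 // lerD ?ramp_le //; last by lra.
apply: le_trans (MP s s1); rewrite ler_piMl // ger0_norm; lra.
Qed.

Lemma bounded01_green_int t : 0 <= t <= 1 -> bounded01 (green_int eta alpha t).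
Proof.
move=> t1; have [M MP] := bounded01_slope; exists (M + 1) => s s1.
have [t0 tle] := andP t1.
have r1 : ramp (t - s) <= 1 by apply: ramp_le; lra.
have r0 := ramp_ge0 (t - s).
apply: le_trans (ler_normB _ _) _; rewrite normrM lerD //.
  apply: le_trans (MP s s1); rewrite ler_piMl // ger0_norm.
    nra.
  by rewrite divr_ge0 // sqr_ge0.
rewrite ger0_norm; last by rewrite divr_ge0 // sqr_ge0.
nra.
Qed.

(** The limits of the discrete solutions, of their derivatives and of
    their second derivatives.  The coefficient 1 in the last one is the
    shape of [dens_comb]. *)
Definition limit_fun b t := dens b (green_int eta alpha t).

Definition limit_slope b t := dens b (green eta alpha t).

Definition limit_curvature b t := dens b (fun s => slope eta alpha s - 1 * (s < t)%R%:R).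

Lemma bounded01_curvature t : bounded01 (fun s => slope eta alpha s - 1 * (s < t)%R%:R).
Proof.
by apply: bounded01_comb; [exact: bounded01_slope|exact: (bounded01_bool (fun s => s < t)%R)].
Qed.

(** Taylor inequalities for the kernels in [t], integrated against [dens]. *)
Lemma limit_fun_taylor b t s : 0 <= t <= 1 -> 0 <= s <= 1 ->
  `|limit_fun b s - limit_fun b t - (s - t) * limit_slope b t|
    <= ((1 - alpha * eta)^-1 + 1) * (s - t) ^+ 2 * B.
Proof.
move=> t1 s1; rewrite -[limit_fun b t]mul1r /limit_fun /limit_slope.
have bs := bounded01_green_int s1; have bt := bounded01_green_int t1.
have bg := bounded01_green t1.
rewrite -dens_comb // -dens_comb //; last exact: bounded01_comb.
apply: dens_bound => x x1.
rewrite (_ : _ - _ = (s - t) ^+ 2 / 2 * slope eta alpha x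
  - (ramp (s - x) ^+ 2 / 2 - ramp (t - x) ^+ 2 / 2 - (s - t) * ramp (t - x))); last first.
  by rewrite /green_int /green; field.
have := half_sqr_ramp_taylor (t - x) (s - x).
rewrite (_ : s - x - (t - x) = s - t); last by ring.
move=> H; apply: le_trans (ler_normB _ _) _; rewrite [leRHS]mulrDl mul1r lerD //.
have q0 := sqr_ge0 (s - t); have a0 := slope_ge0 dataP x1.
have a1 := slope_le dataP x1; rewrite ger0_norm; last first.
  by rewrite mulr_ge0 // divr_ge0.
rewrite mulrC; apply: ler_pM => //; first by rewrite divr_ge0.
by rewrite ler_pdivrMr // ler_peMr // ler1n.
Qed.

(** The forcings are bounded by [B] and the nodes are equidistributed. *)
Lemma dens_itv_le b lo hi : 0 <= lo -> lo <= hi -> hi <= 1 ->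
  dens b (fun s => (lo <= s < hi)%R%:R) <= B * (hi - lo).
Proof.
move=> lo0 lohi hi1; have bb := bounded01_bool (fun s => lo <= s < hi)%R.
have c : B * (hi - lo + n.+1%:R^-1) @[n --> U] --> B * (hi - lo).
  rewrite -[X in _ --> B * X]addr0; apply: cvgMl_tmp; apply: cvgD; first exact: cvg_cst.
  exact: ulim_invS.
apply: (ler_cvg_to (dens_cvg b bb) c); apply: nearW => n.
apply: le_trans (_ : B * mean (fun j : 'I_n.+1 => (lo <= node R j < hi)%R%:R) <= _).
  rewrite -meanZ; apply: mean_le => j; rewrite mulrC ler_wpM2r //.
  exact: g_le.
rewrite ler_wpM2l ?density_bound_ge0 //.
by have := mean_itv n lo0 lohi hi1; rewrite ler_distl div1r => /andP[].
Qed.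

(** The remainder is supported on the poles between [t] and [s], whose
    [dens] is at most [B] times the distance. *)
Lemma limit_slope_taylor b t s : 0 <= t <= 1 -> 0 <= s <= 1 ->
  `|limit_slope b s - limit_slope b t - (s - t) * limit_curvature b t| <= B * `|s - t| * `|s - t|.
Proof.
move=> t1 s1; rewrite -[limit_slope b t]mul1r /limit_slope /limit_curvature.
have bs := bounded01_green s1; have bt := bounded01_green t1.
have bg := bounded01_curvature t.
rewrite -dens_comb // -dens_comb //; last exact: bounded01_comb.
pose lo := Num.min t s; pose hi := Num.max t s.
have bb := bounded01_bool (fun x => lo <= x < hi)%R.
have bz : bounded01 (fun=> 0) by exists 0 => x _; rewrite normr0.
apply: le_trans (dens_norm (K2 := fun x => 0 - (- `|s - t|) * (lo <= x < hi)%R%:R) _ _ _ _) _.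
- by apply: bounded01_comb => //; exact: bounded01_comb.
- exact: bounded01_comb.
- move=> x x1; rewrite sub0r mulNr opprK; have := ramp_taylor x t s.
  apply: le_trans; rewrite -normrN le_eqVlt; apply/orP; left; apply/eqP; congr `|_|.
  by rewrite /green; ring.
rewrite dens_comb // mulNr opprK.
have -> : dens b (fun=> 0) = 0.
  apply/eqP; rewrite -normr_le0 -[X in _ <= X](mul0r B).
  by apply: dens_bound => x _; rewrite normr0.
rewrite add0r mulrC ler_wpM2r //.
have hl : hi - lo = `|s - t|.
  by rewrite /hi /lo; case: (leP t s) => ts; [rewrite ger0_norm|rewrite distrC ger0_norm]; lra.
rewrite -hl; apply: dens_itv_le.
- by rewrite le_min; apply/andP; split; [case/andP: t1|case/andP: s1].
- by rewrite /lo /hi; case: (leP t s) => // /ltW.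
- by rewrite ge_max; apply/andP; split; [case/andP: t1|case/andP: s1].
Qed.


Lemma densZ b (k : R) K : bounded01 K -> dens b (fun s => k * K s) = k * dens b K.
Proof.
move=> bK; rewrite [RHS](_ : _ = dens b K - (1 - k) * dens b K); last by ring.
by rewrite -dens_comb //; apply: dens_ext => s _; ring.
Qed.

Lemma dens0 b : dens b (fun=> 0) = 0.
Proof.
apply/eqP; rewrite -normr_le0 -[X in _ <= X](mul0r B).
by apply: dens_bound => x _; rewrite normr0.
Qed.

Lemma limit_slope_three_point b : limit_slope b 1 = alpha * limit_slope b eta.
Proof.
have [eta0 eta1 _ _] := dataP.
rewrite /limit_slope -densZ; last by apply: bounded01_green; lra.
by apply: dens_ext => s s1; rewrite (green_three_point dataP).
Qed.

Lemma limit_slope_0 b : limit_slope b 0 = 0.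
Proof.
rewrite /limit_slope -[RHS](dens0 b); apply: dens_ext => s s1.
by rewrite /green mul0r ramp_neg ?subr0 // sub0r oppr_le0; case/andP: s1.
Qed.

Lemma limit_fun_0 b : limit_fun b 0 = 0.
Proof.
rewrite /limit_fun -[RHS](dens0 b); apply: dens_ext => s s1.
rewrite /green_int ramp_neg; first by rewrite !expr0n /= !mul0r subr0.
by rewrite sub0r oppr_le0; case/andP: s1.
Qed.

Lemma pot_cvg b t : 0 <= t <= 1 -> pot eta alpha (comp n b) t @[n --> U] --> limit_fun b t.
Proof. by move=> t1; apply: dens_cvg (bounded01_green_int t1). Qed.

Lemma slope_pot_cvg b t : 0 <= t <= 1 ->
  slope_pot eta alpha (comp n b) t @[n --> U] --> limit_slope b t.
Proof. by move=> t1; apply: dens_cvg (bounded01_green t1). Qed.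

#[local] Arguments pot_cvg b {t} _.
#[local] Arguments slope_pot_cvg b {t} _.

Lemma eta_itv : 0 <= eta <= 1.
Proof. by have [eta0 eta1 _ _] := dataP; rewrite !ltW. Qed.

Lemma limit_slope_eta_ge0 b : 0 <= limit_slope b eta.
Proof.
apply: (cvgr_to_ge (slope_pot_cvg b eta_itv)); apply: nearW => n.
exact: (load_ge0 dataP (@comp_ge0 n b)).
Qed.

Lemma limit_slope_ge b t : 0 <= t <= 1 -> t * limit_slope b eta <= limit_slope b t.
Proof.
move=> t1; have c := slope_pot_cvg b eta_itv.
apply: (ler_cvg_to (cvgMl_tmp c) (slope_pot_cvg b t1)).
by apply: nearW => n; exact: (slope_pot_ge dataP (@comp_ge0 n b) t1).
Qed.

Lemma limit_slope_le b t : 0 <= t <= 1 -> limit_slope b t <= limit_slope b eta / eta.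
Proof.
move=> t1; have c := slope_pot_cvg b eta_itv.
apply: (ler_cvg_to (slope_pot_cvg b t1) (cvgMr_tmp c)).
by apply: nearW => n; exact: (slope_pot_le dataP (@comp_ge0 n b) t1).
Qed.

Lemma limit_fun_ge b t : 0 <= t <= 1 -> t ^+ 2 / 2 * limit_slope b eta <= limit_fun b t.
Proof.
move=> t1; have c := slope_pot_cvg b eta_itv.
apply: (ler_cvg_to (cvgMl_tmp c) (pot_cvg b t1)).
by apply: nearW => n; exact: (pot_ge dataP (@comp_ge0 n b) t1).
Qed.

Lemma limit_slope_ge0 b t : 0 <= t <= 1 -> 0 <= limit_slope b t.
Proof.
move=> t1; apply: le_trans (limit_slope_ge b t1).
by rewrite mulr_ge0 ?limit_slope_eta_ge0 //; case/andP: t1.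
Qed.

Lemma limit_fun_ge0 b t : 0 <= t <= 1 -> 0 <= limit_fun b t.
Proof.
move=> t1; apply: le_trans (limit_fun_ge b t1).
by rewrite mulr_ge0 ?limit_slope_eta_ge0 // divr_ge0 // sqr_ge0.
Qed.

Lemma mean_lipschitz n b (K1 K2 : R -> R) (d : R) :
  (forall x, 0 <= x <= 1 -> `|K1 x - K2 x| <= d) ->
  `|mean (fun j => K1 (node R j) * comp n b j)
    - mean (fun j => K2 (node R j) * comp n b j)| <= d * B.
Proof.
move=> KK; rewrite -meanB; apply: le_trans (norm_mean _) _.
rewrite -(mean_cst n (d * B)); apply: mean_le => j.
rewrite -mulrBl normrM (ger0_norm (comp_ge0 _ _)).
by apply: ler_pM => //; [exact: comp_ge0|exact/KK/node_itv|exact: g_le].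
Qed.

Lemma slope_pot_lipschitz n b t s : 0 <= t <= 1 -> 0 <= s <= 1 ->
  `|slope_pot eta alpha (comp n b) s - slope_pot eta alpha (comp n b) t|
    <= `|s - t| * ((1 - alpha * eta)^-1 + 1) * B.
Proof.
move=> t1 s1; apply: mean_lipschitz => x x1.
rewrite (_ : _ - _ = (s - t) * slope eta alpha x - (ramp (s - x) - ramp (t - x)));
  last by rewrite /green; ring.
apply: le_trans (ler_normB _ _) _; rewrite normrM mulrDr mulr1 lerD //.
  rewrite ler_wpM2l // ger0_norm ?(slope_le dataP) //; exact: slope_ge0 dataP _ _.
by apply: le_trans (ramp_lipschitz _ _) _; rewrite opprB addrA subrK.
Qed.

Lemma half_sqr_lipschitz (x y : R) : 0 <= x <= 1 -> 0 <= y <= 1 ->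
  `|x ^+ 2 / 2 - y ^+ 2 / 2| <= `|x - y|.
Proof.
move=> x1 y1; rewrite (_ : _ - _ = (x - y) * ((x + y) / 2)); last by field.
rewrite normrM ler_piMr // ger0_norm; lra.
Qed.

Lemma pot_lipschitz n b t s : 0 <= t <= 1 -> 0 <= s <= 1 ->
  `|pot eta alpha (comp n b) s - pot eta alpha (comp n b) t|
    <= `|s - t| * ((1 - alpha * eta)^-1 + 1) * B.
Proof.
move=> t1 s1; apply: mean_lipschitz => x x1.
rewrite (_ : _ - _ = (s ^+ 2 / 2 - t ^+ 2 / 2) * slope eta alpha x
  - (ramp (s - x) ^+ 2 / 2 - ramp (t - x) ^+ 2 / 2)); last by rewrite /green_int; ring.
have r1 u : 0 <= u <= 1 -> 0 <= ramp (u - x) <= 1.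
  by move=> u1; rewrite ramp_ge0 ramp_le //; lra.
apply: le_trans (ler_normB _ _) _; rewrite normrM mulrDr mulr1 lerD //.
  apply: ler_pM => //; first exact: half_sqr_lipschitz.
  by rewrite ger0_norm ?(slope_le dataP) // (slope_ge0 dataP).
apply: le_trans (half_sqr_lipschitz (r1 _ s1) (r1 _ t1)) _.
by apply: le_trans (ramp_lipschitz _ _) _; rewrite opprB addrA subrK.
Qed.

Variable F : bool -> R -> R -> R -> R.
Hypothesis F_cont : forall b, continuous_on_domain (F b).
Hypothesis F_ge0 : forall b, nonneg_on_domain (F b).
Hypothesis g_fix : \forall n \near U, forcing eta alpha F n.+1%:R^-1 (@g n) = @g n.

(** The right-hand side of equation [b] along the limit functions. *)
Definition limit_forcing b t := F b t (limit_fun (~~ b) t) (limit_slope (~~ b) t).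

Let discrete_forcing n b t := F b t (pot eta alpha (comp n (~~ b)) t)
  (slope_pot eta alpha (comp n (~~ b)) t).

Lemma discrete_forcing_cvg b t : 0 <= t <= 1 -> discrete_forcing n b t @[n --> U] --> limit_forcing b t.
Proof.
move=> t1; apply: continuous_on_domain_cvg => //.
- move=> n; split=> //; first exact: (pot_ge0 dataP (@comp_ge0 n _)).
  exact: (slope_pot_ge0 dataP (@comp_ge0 n _)).
- exact: limit_fun_ge0.
- exact: limit_slope_ge0.
- exact: cvg_cst.
- exact: pot_cvg.
- exact: slope_pot_cvg.
Qed.

(** Joint convergence in the grid and the point: the discrete solutions
    are equi-Lipschitz, so pointwise convergence at [t] alone controls
    them near [t]. *)
Lemma discrete_forcing_local b (t e : R) : 0 <= t <= 1 -> 0 < e ->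
  exists2 d, 0 < d & \forall n \near U, forall s, 0 <= s <= 1 -> `|s - t| < d ->
    `|discrete_forcing n b s - limit_forcing b t| <= e.
Proof.
move=> t1 e0.
have [d d0 dP] := continuous_on_domain_eps (@F_cont b) t1
  (limit_fun_ge0 (~~ b) t1) (limit_slope_ge0 (~~ b) t1) e0.
have [eta0 eta1 alpha1 kappa0] := dataP.
have C0 : 0 <= ((1 - alpha * eta)^-1 + 1) * B.
  by rewrite mulr_ge0 ?density_bound_ge0 // addr_ge0 // invr_ge0 ltW.
set C := _ * B in C0; have C1 : 0 < C + 1 by lra.
exists (Num.min d (d / 2 / (C + 1))).
  by rewrite lt_min d0 !divr_gt0.
have d2 : 0 < d / 2 by rewrite divr_gt0.
have /cvgrPdist_lt/(_ _ d2) np := pot_cvg (~~ b) t1.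
have /cvgrPdist_lt/(_ _ d2) ns := slope_pot_cvg (~~ b) t1.
apply: filterS2 np ns => n np ns s s1; rewrite lt_min => /andP[sd sd'].
have sC : `|s - t| * C < d / 2.
  rewrite ltr_pdivlMr // in sd'; apply: le_lt_trans sd'.
  by rewrite ler_wpM2l // lerDl.
have Lp := pot_lipschitz n (~~ b) t1 s1; rewrite -mulrA -/C in Lp.
have Ls := slope_pot_lipschitz n (~~ b) t1 s1; rewrite -mulrA -/C in Ls.
apply: dP => //; try exact: (pot_ge0 dataP (@comp_ge0 n _)).
- exact: (slope_pot_ge0 dataP (@comp_ge0 n _)).
- rewrite distrC in np; set p := pot _ _ _ s in Lp *; set p' := pot _ _ _ t in Lp np.
  rewrite (_ : p - _ = (p - p') + (p' - limit_fun (~~ b) t)); last by ring.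
  apply: le_lt_trans (ler_normD _ _) _; lra.
- rewrite distrC in ns; set p := slope_pot _ _ _ s in Ls *.
  set p' := slope_pot _ _ _ t in Ls ns.
  rewrite (_ : p - _ = (p - p') + (p' - limit_slope (~~ b) t)); last by ring.
  apply: le_lt_trans (ler_normD _ _) _; lra.
Qed.

Lemma limit_forcing_cont b (t e : R) : 0 <= t <= 1 -> 0 < e ->
  exists2 d, 0 < d & forall s, 0 <= s <= 1 -> `|s - t| < d ->
    `|limit_forcing b s - limit_forcing b t| <= e.
Proof.
move=> t1 e0; have [d d0 dP] := discrete_forcing_local b t1 e0; exists d => // s s1 st.
have c : `|discrete_forcing n b s - limit_forcing b t| @[n --> U] --> `|limit_forcing b s - limit_forcing b t|.
  by apply: cvg_norm; apply: cvgB; [exact: discrete_forcing_cvg|exact: cvg_cst].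
by apply: (cvgr_to_le c); apply: filterS dP => n; apply.
Qed.

(** On short intervals around [t] the discrete forcing is nearly constant,
    so the limit functional has density [limit_forcing] there. *)
Lemma dens_itv_forcing b (t e : R) : 0 <= t <= 1 -> 0 < e ->
  exists2 d, 0 < d & forall lo hi, 0 <= lo -> lo <= hi -> hi <= 1 ->
    `|lo - t| < d -> `|hi - t| < d ->
    `|dens b (fun s => (lo <= s < hi)%R%:R) - limit_forcing b t * (hi - lo)| <= e * (hi - lo).
Proof.
move=> t1 e0; have [d d0 dP] := discrete_forcing_local b t1 e0; exists d => //.
move=> lo hi lo0 lohi hi1 lod hid.
have bb := bounded01_bool (fun s => lo <= s < hi)%R.
pose m n := mean (fun j : 'I_n.+1 => (lo <= node R j < hi)%R%:R * comp n b j).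
have c : `|m n - limit_forcing b t * (hi - lo)| @[n --> U] -->
    `|dens b (fun s => (lo <= s < hi)%R%:R) - limit_forcing b t * (hi - lo)|.
  by apply: cvg_norm; apply: cvgB; [exact: dens_cvg bb|exact: cvg_cst].
have c' : (e + n.+1%:R^-1) * (hi - lo + n.+1%:R^-1) + `|limit_forcing b t| * n.+1%:R^-1
    @[n --> U] --> (e + 0) * (hi - lo + 0) + `|limit_forcing b t| * 0.
  apply: cvgD; last by apply: cvgMl_tmp; exact: ulim_invS.
  by apply: cvgM; apply: cvgD; first [exact: cvg_cst|exact: ulim_invS].
rewrite !addr0 mulr0 addr0 in c'.
apply: (ler_cvg_to c c'); apply: filterS2 dP g_fix => n dP fx.
set h := n.+1%:R^-1; have h0 : 0 <= h by rewrite invr_ge0.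
pose i j : R := (lo <= @node R n j < hi)%R%:R.
have mi := @mean_itv R n lo hi lo0 lohi hi1; rewrite div1r -/h -/i in mi.
have -> : m n - limit_forcing b t * (hi - lo) =
    mean (fun j => i j * (comp n b j - limit_forcing b t)) + limit_forcing b t * (mean i - (hi - lo)).
  rewrite [X in _ = _ + X]mulrBr addrA; congr (_ - _); rewrite /m -meanZ -meanD; apply: eq_mean => j.
  by rewrite /i; ring.
apply: le_trans (ler_normD _ _) _; rewrite lerD //; last first.
  by rewrite normrM ler_wpM2l.
apply: le_trans (norm_mean _) _.
apply: le_trans (_ : (e + h) * mean i <= _); last first.
  rewrite ler_wpM2l //; first by rewrite addr_ge0 // ltW.
  by move: mi; rewrite ler_distl => /andP[].
rewrite -meanZ; apply: mean_le => j; rewrite normrM /i.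
have [/andP[lj jh]|_] := boolP (lo <= node R j < hi)%R; last by rewrite normr0 mul0r mulr0.
have nt : `|node R j - t| < d.
  by move: lod hid; rewrite !ltr_distl => /andP[? ?] /andP[? ?]; apply/andP; split; lra.
rewrite normr1 mul1r mulr1.
have -> : comp n b j = discrete_forcing n b (node R j) + h.
  by rewrite /component -{1}fx.
rewrite addrAC; have Hz := dP (node R j) (node_itv R j) nt.
by apply: le_trans (ler_normD _ _) _; rewrite lerD // ger0_norm.
Qed.

Lemma limit_curvature_taylor b (t e : R) : 0 <= t <= 1 -> 0 < e ->
  exists2 d, 0 < d & forall s, 0 <= s <= 1 -> `|s - t| < d ->
    `|limit_curvature b s - limit_curvature b t - (s - t) * - limit_forcing b t| <= e * `|s - t|.
Proof.
move=> t1 e0; have [d d0 dP] := dens_itv_forcing b t1 e0; exists d => // s s1 st.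
have diff x y : x <= y -> limit_curvature b x - limit_curvature b y = dens b (fun z => (x <= z < y)%R%:R).
  move=> xy; rewrite -[limit_curvature b y]mul1r /limit_curvature -dens_comb; last 2 first.
  - exact: bounded01_curvature.
  - exact: bounded01_curvature.
  apply: dens_ext => z _; rewrite !mul1r.
  case: (ltP z x) => zx /=; last by rewrite subr0 opprB addrC subrK.
  by rewrite (lt_le_trans zx xy) /= subrr.
have tt : `|t - t| < d by rewrite subrr normr0.
have [t0 tl] := andP t1; have [s0 sl] := andP s1.
have [ts|/ltW st'] := leP t s.
  rewrite (_ : _ - _ = - (limit_curvature b t - limit_curvature b s - limit_forcing b t * (s - t))); last by ring.
  by rewrite normrN diff // (ger0_norm (x := s - t)) ?subr_ge0 // dP.
rewrite (_ : _ - _ = limit_curvature b s - limit_curvature b t - limit_forcing b t * (t - s)); last by ring.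
by rewrite diff // (distrC s t) (ger0_norm (x := t - s)) ?subr_ge0 // dP.
Qed.

(** The three Taylor inequalities; the first two have quadratic
    remainders. *)
Lemma limit_derivatives b :
  [/\ has_derivative01 (limit_fun b) (limit_slope b), has_derivative01 (limit_slope b) (limit_curvature b)
    & has_derivative01 (limit_curvature b) (fun t => - limit_forcing b t)].
Proof.
have quad C e : 0 <= C -> 0 < e -> exists2 d : R, 0 < d &
    forall x : R, `|x| < d -> C * `|x| * `|x| <= e * `|x|.
  move=> C0 e0; have C1 : 0 < C + 1 by lra.
  exists (e / (C + 1)) => [|x]; first by rewrite divr_gt0.
  rewrite ltr_pdivlMr // => xe; rewrite ler_wpM2r //.
  by apply: le_trans (ltW xe); rewrite mulrC ler_wpM2l // lerDl.
have [eta0 eta1 alpha1 kappa0] := dataP.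
split; apply: has_derivative01P => t e t1 e0.
- have C0 : 0 <= ((1 - alpha * eta)^-1 + 1) * B.
    by rewrite mulr_ge0 ?density_bound_ge0 // addr_ge0 // invr_ge0 ltW.
  have [d d0 dP] := quad _ e C0 e0; exists d => // s s1 st.
  apply: le_trans (limit_fun_taylor b t1 s1) _; apply: le_trans (dP _ st).
  rewrite -(real_normK (num_real (s - t))) le_eqVlt; apply/orP; left.
  by apply/eqP; ring.
- have [d d0 dP] := quad _ e density_bound_ge0 e0; exists d => // s s1 st.
  exact: le_trans (limit_slope_taylor b t1 s1) (dP _ st).
- exact: limit_curvature_taylor.
Qed.

Lemma limit_slope_linear_le b t : 0 <= t <= 1 ->
  limit_slope b t <= t * ((1 - alpha * eta)^-1 * B).
Proof.
move=> t1; have [t0 tl] := andP t1.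
apply: le_trans (ler_norm _) _; rewrite mulrA; apply: dens_bound => s s1.
have gs : 0 <= green eta alpha t s.
  apply: le_trans (green_ge dataP t1 s1).
  by rewrite mulr_ge0 // (green_eta_ge0 dataP).
rewrite ger0_norm // /green; have := ler_wpM2l t0 (slope_le dataP s1).
by have := ramp_ge0 (t - s); lra.
Qed.

Lemma limit_fun_linear_le b t : 0 <= t <= 1 ->
  limit_fun b t <= t * ((1 - alpha * eta)^-1 * B).
Proof.
move=> t1; have [t0 tl] := andP t1.
apply: le_trans (ler_norm _) _; rewrite mulrA; apply: dens_bound => s s1.
have gs : 0 <= green_int eta alpha t s.
  apply: le_trans (green_int_ge dataP t1 s1).
  by rewrite mulr_ge0 ?(green_eta_ge0 dataP) // divr_ge0 // sqr_ge0.
rewrite ger0_norm // /green_int.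
have H : t ^+ 2 / 2 * slope eta alpha s <= t * (1 - alpha * eta)^-1.
  apply: ler_pM; rewrite ?(slope_ge0 dataP) ?(slope_le dataP) ?divr_ge0 ?sqr_ge0 //.
  by rewrite ler_pdivrMr // expr2 ler_wpM2l //; lra.
apply: le_trans H; rewrite gerBl divr_ge0 // sqr_ge0 //.
Qed.

(** Near the origin the size of one forcing is at most a multiple of the
    size of the other plus a vanishing constant. *)
Lemma limit_slope_eta_vanish b : small_upper (F b) -> limit_slope (~~ b) eta = 0 ->
  limit_slope b eta = 0.
Proof.
have [eta0 eta1 alpha1 kappa0] := dataP => Fs z; apply/le_anti.
rewrite limit_slope_eta_ge0 andbT; have [rho rho0 rhoP] := Fs 1 ltr01.
have c := slope_pot_cvg (~~ b) eta_itv; rewrite z in c.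
have c' : (1 - alpha * eta)^-1 * (1 * (2 / eta * slope_pot eta alpha (comp n (~~ b)) eta)
    + 0 + n.+1%:R^-1) @[n --> U] --> (1 - alpha * eta)^-1 * (1 * (2 / eta * 0) + 0 + 0).
  apply: cvgMl_tmp; apply: cvgD; last exact: ulim_invS.
  apply: cvgD; last exact: cvg_cst.
  by do 2!apply: cvgMl_tmp.
rewrite mulr0 mulr0 !addr0 mulr0 in c'.
apply: (ler_cvg_to (slope_pot_cvg b eta_itv) c').
have re : 0 < rho * eta by rewrite mulr_gt0.
have /cvgr0Pnorm_le/(_ _ re) := c; apply: filterS2 g_fix => n fx L.
have L' : load eta alpha (comp n (~~ b)) <= rho * eta := le_trans (ler_norm _) L.
have e0 : 0 <= n.+1%:R^-1 :> R by rewrite invr_ge0.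
rewrite -{1}fx; apply: (load_forcing_le dataP F_ge0 (@g_ge0 n) e0 ler01 (lexx 0)).
have L2 : load eta alpha (comp n (~~ b)) / eta <= rho by rewrite ler_pdivrMr.
move=> t x y t1 /andP[x0 x1] /andP[y0 y1]; rewrite addr0; apply: rhoP => //.
  by rewrite x0 (le_trans x1).
by rewrite y0 (le_trans y1).
Qed.

(** If the solution of equation [b] were 0, so would be its third
    derivative, hence the right-hand side.  For small [t] the other
    solution is small but has positive derivative, and there the
    right-hand side is positive. *)
Lemma limit_slope_eta_nonzero b : small_lower (F b) -> 0 < limit_slope (~~ b) eta ->
  limit_slope b eta != 0.
Proof.
have [eta0 eta1 alpha1 kappa0] := dataP => Fs l0; apply/eqP => z.
have [D01 D12 D23] := limit_derivatives b.
have d1 t : unit_itv t -> limit_slope b t = 0.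
  move=> t1; apply/le_anti; rewrite limit_slope_ge0 // andbT.
  by apply: le_trans (limit_slope_le b t1) _; rewrite z mul0r.
have zero : has_derivative01 (fun=> 0) (fun=> (0 : R)).
  apply: has_derivative01P => t e t1 e0; exists 1 => // s s1 _.
  by rewrite mulr0 !subr0 normr0 mulr_ge0 // ltW.
have d2 t : unit_itv t -> limit_curvature b t = 0.
  move=> t1; apply: (has_derivative01_uniq t1 D12).
  by apply: eq_has_derivative01 zero => // s /d1.
have d3 t : unit_itv t -> - limit_forcing b t = 0.
  move=> t1; apply: (has_derivative01_uniq t1 D23).
  by apply: eq_has_derivative01 zero => // s /d2.
have [rho rho0 rhoP] := Fs 1 ltr01.
have A0 : 0 <= (1 - alpha * eta)^-1 * B by rewrite mulr_ge0 ?density_bound_ge0 // invr_ge0 ltW.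
set A := _ * B in A0; have A1 : 0 < A + 1 by lra.
pose t := Num.min 1 (rho / (A + 1)).
have t0 : 0 < t by rewrite lt_min ltr01 divr_gt0.
have t1 : 0 <= t <= 1 by rewrite ltW //= ge_min lexx.
have tA : t * A <= rho.
  apply: le_trans (_ : t * (A + 1) <= _); first by rewrite (ler_wpM2l (ltW t0)) // lerDl.
  by rewrite -ler_pdivlMr // ge_min lexx orbT.
have := rhoP t (limit_fun (~~ b) t) (limit_slope (~~ b) t) t1.
rewrite limit_fun_ge0 // limit_slope_ge0 //=.
rewrite (le_trans (limit_fun_linear_le _ t1) tA) (le_trans (limit_slope_linear_le _ t1) tA).
move=> /(_ isT isT); rewrite -/(limit_forcing b t).
have -> : limit_forcing b t = 0 by apply/eqP; rewrite -oppr_eq0; apply/eqP/d3.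
have := limit_slope_ge (~~ b) t1; have := mulr_gt0 t0 l0; have := limit_fun_ge0 (~~ b) t1.
lra.
Qed.

End Limit.

(** * The boundary value problem *)

(** A bound on the size bounds the solutions, hence, by compactness, the
    right-hand sides. *)
Lemma fixpoint_bounded (R : realType) (eta alpha : R) (F : bool -> R -> R -> R -> R)
    (K : R) : three_point_data eta alpha -> (forall b, continuous_on_domain (F b)) ->
  exists2 B, 0 <= B & forall n (g : bool * 'I_n.+1 -> R), orthant g ->
    forcing eta alpha F n.+1%:R^-1 g = g -> total_load eta alpha g <= K ->
    forall i, g i <= B.
Proof.
move=> dataP Fc; have [eta0 _ _ _] := dataP.
have [Dt Dt0 DtP] := domain_bounded (Fc true) (K / eta).
have [Df Df0 DfP] := domain_bounded (Fc false) (K / eta).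
exists (Dt + Df + 1) => [|n g g0 fx gK [b j]]; first by rewrite !addr_ge0.
have c0 b' k : 0 <= component g b' k by apply: g0.
have sj := node_itv R j.
have LK b' : load eta alpha (component g b') / eta <= K / eta.
  rewrite ler_pM2r ?invr_gt0 //; apply: le_trans gK.
  by rewrite (total_loadE _ _ g b') lerDl (load_ge0 dataP (c0 _)).
have P b' : 0 <= pot eta alpha (component g b') (node R j) <= K / eta.
  by rewrite (pot_ge0 dataP (c0 _)) // (le_trans (pot_le dataP (c0 _) sj)).
have S b' : 0 <= slope_pot eta alpha (component g b') (node R j) <= K / eta.
  by rewrite (slope_pot_ge0 dataP (c0 _)) // (le_trans (slope_pot_le dataP (c0 _) sj)).
rewrite -fx /forcing /= lerD //; last by rewrite invf_le1 ?natS_gt0 // ler1n.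
case: b => /=.
  by apply: le_trans (DtP _ _ _ sj (P _) (S _)) _; rewrite lerDl.
by apply: le_trans (DfP _ _ _ sj (P _) (S _)) _; rewrite lerDr.
Qed.

(** Indices below the threshold get the zero forcing, so that positivity
    and boundedness hold for every index and only the equation is
    asymptotic. *)
Lemma bounded_approximations (R : realType) (eta alpha : R)
    (F : bool -> R -> R -> R -> R) :
  three_point_data eta alpha -> (forall b, continuous_on_domain (F b)) ->
  (forall b, nonneg_on_domain (F b)) ->
  (forall b, small_upper (F b)) /\ (forall b, large_lower (F b)) \/
  (forall b, small_lower (F b)) /\ (forall b, large_upper (F b)) ->
  exists (r B : R) (g : forall n, bool * 'I_n.+1 -> R),
    [/\ 0 < r, forall n, orthant (g n), forall n i, g n i <= B &
      \forall n \near \oo, forcing eta alpha F n.+1%:R^-1 (g n) = g n /\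
        r <= total_load eta alpha (g n)].
Proof.
move=> dataP Fc F0 growth.
have [r [K [r0 near_ex]]] := discrete_fixpoints dataP Fc F0 growth.
have [B B0 BP] := fixpoint_bounded K dataP Fc.
have pick n : exists g : bool * 'I_n.+1 -> R, [/\ orthant g, forall i, g i <= B &
    (exists g : bool * 'I_n.+1 -> R,
      [/\ orthant g, forcing eta alpha F (n.+1%:R)^-1 g = g
        & r <= total_load eta alpha g <= K]) ->
    forcing eta alpha F n.+1%:R^-1 g = g /\ r <= total_load eta alpha g].
  have [[g [g0 fx /andP[rg gK]]]|none] := pselect (exists g : bool * 'I_n.+1 -> R,
      [/\ orthant g, forcing eta alpha F (n.+1%:R)^-1 g = g
        & r <= total_load eta alpha g <= K]).
    by exists g; split=> //; apply: BP.
  by exists (fun=> 0); split.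
pose g n := projT1 (cid (pick n)); have gP n := projT2 (cid (pick n)).
exists r, B, g; split=> //.
- by move=> n; have [] := gP n.
- by move=> n; have [] := gP n.
- by apply: filterS near_ex => n; have [_ _] := gP n; apply.
Qed.

Theorem theorem6 (R : realType) (eta alpha : R) (f h : R -> R -> R -> R)
    (eta_bounds : 0 < eta /\ eta < 1)
    (alpha_bounds : 1 < alpha /\ alpha < 1 / eta)
    (f_cont : continuous_on_domain f) (h_cont : continuous_on_domain h)
    (f_ge0 : nonneg_on_domain f) (h_ge0 : nonneg_on_domain h)
    (growth :
       let A1 := sublinear_at near_origin f /\ sublinear_at near_origin h in
       let A2 := superlinear_at near_infinity f /\
                 superlinear_at near_infinity h in
       let A3 := superlinear_at near_origin f /\
                 superlinear_at near_origin h in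
       let A4 := sublinear_at near_infinity f /\
                 sublinear_at near_infinity h in
       (A1 /\ A2) \/ (A3 /\ A4)) :
  exists u v : R -> R,
    bvp_solution eta alpha f h u v /\
    (forall t, 0 < t /\ t <= 1 -> 0 < u t /\ 0 < v t).
Proof.
have [eta0 eta1] := eta_bounds; have [alpha1 alphae] := alpha_bounds.
have dataP : three_point_data eta alpha.
  by split=> //; rewrite subr_gt0 -ltr_pdivlMr.
pose F (b : bool) := if b then f else h.
have Fc b : continuous_on_domain (F b) by case: b.
have F0 b : nonneg_on_domain (F b) by case: b.
have Fgrowth : (forall b, small_upper (F b)) /\ (forall b, large_lower (F b)) \/
    (forall b, small_lower (F b)) /\ (forall b, large_upper (F b)).
  case: growth => [[[? ?] [? ?]]|[[? ?] [? ?]]]; [left|right]; split; case.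
  - exact: sublinear_small_upper.
  - exact: sublinear_small_upper.
  - exact: superlinear_large_lower.
  - exact: superlinear_large_lower.
  - exact: superlinear_small_lower.
  - exact: superlinear_small_lower.
  - exact: sublinear_large_upper.
  - exact: sublinear_large_upper.
have [r [B [g [r0 g0 gB near_g]]]] := bounded_approximations dataP Fc F0 Fgrowth.
have [U [UU freeU]] := free_ultrafilter.
have UP := @ultra_proper _ _ UU.
have fx : \forall n \near U, forcing eta alpha F n.+1%:R^-1 (g n) = g n.
  by apply: freeU; apply: filterS near_g => n [].
pose u b := limit_fun eta alpha U g b; pose u' b := limit_slope eta alpha U g b.
pose w b := limit_forcing eta alpha U g F b.
have eta_in := eta_itv dataP.
have sum_ge : r <= u' true eta + u' false eta.
  have ct := slope_pot_cvg dataP UU g0 gB (b := true) eta_in.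
  have cf := slope_pot_cvg dataP UU g0 gB (b := false) eta_in.
  apply: (cvgr_to_ge (cvgD ct cf)); apply: freeU.
  by apply: filterS near_g => n [].
have u'_ge0 b : 0 <= u' b eta := limit_slope_eta_ge0 dataP UU g0 gB b.
have u'_gt0 b : 0 < u' b eta.
  have sum_b : r <= u' b eta + u' (~~ b) eta by case: b => //; rewrite addrC.
  rewrite lt_neqAle eq_sym u'_ge0 andbT.
  have [z|nz] := eqVneq (u' (~~ b) eta) 0.
    by apply/eqP => zb; move: sum_b; rewrite z zb addr0 leNgt r0.
  have l0 : 0 < u' (~~ b) eta by rewrite lt_neqAle eq_sym nz u'_ge0.
  case: Fgrowth => -[Fs _].
    apply: contra nz => /eqP zb; apply/eqP.
    by apply: (limit_slope_eta_vanish dataP UU freeU g0 gB F0 fx (Fs _)); rewrite negbK.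
  exact: (limit_slope_eta_nonzero dataP UU freeU g0 gB Fc fx (Fs _) l0).
have chain b : [/\ C01 3 (u b), forall t, unit_itv t -> derive01 (u b) t = u' b t &
    forall t, unit_itv t -> derive01n 3 (u b) t = - w b t].
  have [D1 D2 D3] := limit_derivatives dataP UU freeU g0 gB Fc fx b.
  apply: C01_3_chain D1 D2 D3 _ => t e t1 e0.
  have [d d0 dP] := limit_forcing_cont dataP UU g0 gB Fc b t1 e0.
  by exists d => // s s1 st; rewrite -opprD normrN; apply: dP.
have i0 : unit_itv (0 : R) by apply/andP; rewrite lexx ler01.
have i1 : unit_itv (1 : R) by apply/andP; rewrite ler01 lexx.
have bc b : boundary_conditions eta alpha (u b).
  have [_ d1 _] := chain b; split; first exact: (limit_fun_0 eta alpha UU g0 gB).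
    by rewrite (d1 0 i0); exact: (limit_slope_0 eta alpha UU g0 gB).
  rewrite (d1 1 i1) (d1 eta eta_in).
  exact: (limit_slope_three_point dataP UU g0 gB).
have quad b t : unit_itv t -> quadrant (u b t, derive01 (u b) t).
  move=> t1; have [_ d1 _] := chain b; split; rewrite /= ?d1 //.
    exact: (limit_fun_ge0 dataP UU g0 gB).
  exact: (limit_slope_ge0 dataP UU g0 gB).
have ode b t : unit_itv t ->
    - derive01n 3 (u b) t = F b t (u (~~ b) t) (derive01 (u (~~ b)) t).
  move=> t1; have [_ _ d3] := chain b; have [_ d1 _] := chain (~~ b).
  by rewrite d3 // opprK d1.
exists (u true), (u false); split.
  have [Ct _ _] := chain true; have [Cf _ _] := chain false.
  split; [exact: conj Ct Cf| | |exact: bc|exact: bc].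
    by move=> t t1; split; exact: quad.
  by move=> t t1; split; [exact: (ode true)|exact: (ode false)].
move=> t [t0 t1]; have tin : 0 <= t <= 1 by rewrite ltW.
have pos b : 0 < u b t.
  apply: lt_le_trans (limit_fun_ge dataP UU g0 gB b tin).
  by rewrite mulr_gt0 // divr_gt0 // exprn_gt0.
by split.
Qed.
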